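(* The split $\rightarrow$ interval problem is NP-complete: given a split graph $G$ and a positive integer $k$, deciding whether there exists $V_-\subseteq V(G)$ with $|V_-|\le k$ such that $G - V_-$ is an interval graph is NP-complete.
   Context: All graphs are finite, simple and undirected. A graph is a split graph if its vertex set can be partitioned into a clique and an independent set. A graph is an interval graph if its vertices can be assigned intervals of the real line so that two vertices are adjacent iff their intervals intersect. *)

(* Defs.v *)
From mathcomp Require Import all_boot all_order all_algebra.
From mathcomp Require Import reals.

Set Implicit Arguments.
Unset Strict Implicit.
Unset Printing Implicit Defensive.

Record sgraph := SGraph {
  vertex :> finType;
  edge : rel vertex;
  edge_sym : symmetric edge;
  edge_irrefl : irreflexive edge }.

Section InducedSubgraph.
Variables (G : sgraph) (S : {set G}).

Let induced_edge : rel {x : G | x \in S} := fun x y => edge (val x) (val y).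

Fact induced_sym : symmetric induced_edge.
Proof. by move=> x y; apply: edge_sym. Qed.

Fact induced_irrefl : irreflexive induced_edge.
Proof. by move=> x; apply: edge_irrefl. Qed.

Definition induced : sgraph := SGraph induced_sym induced_irrefl.

End InducedSubgraph.

Definition del_vertices (G : sgraph) (V : {set G}) : sgraph := induced (~: V).

Definition is_clique (G : sgraph) (K : {set G}) : Prop :=
  {in K &, forall u v, u != v -> edge u v}.

Definition is_independent (G : sgraph) (I : {set G}) : Prop :=
  {in I &, forall u v, ~~ edge u v}.

Definition split_graph (G : sgraph) : Prop :=
  exists K : {set G}, is_clique K /\ is_independent (~: K).

(* [interval R] contains the open, closed, half-open and unbounded intervals,
   and also empty ones such as `]1, 0[, which are excluded explicitly. *)
Definition interval_graph (R : realType) (G : sgraph) : Prop :=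
  exists I : G -> interval R,
    (forall v, exists x, x \in I v) /\
    (forall u v, u != v -> edge u v <-> exists x, x \in I u /\ x \in I v).

Definition word := seq bool.
Definition language := word -> Prop.

Inductive direction := GoLeft | Stay | GoRight.

(* A tape over S, infinite in both directions: (l, r) has the head on the first
   cell of r, l lists the cells left of the head starting with the nearest one,
   and all the cells beyond l and r are blank. [None] is the blank symbol. *)
Definition tape (S : Type) : Type := (seq (option S) * seq (option S))%type.

Definition tape_read S (t : tape S) : option S := head None t.2.

Definition tape_write S (a : option S) (t : tape S) : tape S :=
  (t.1, a :: behead t.2).

Definition tape_move S (d : direction) (t : tape S) : tape S :=
  match d with
  | GoLeft => (behead t.1, head None t.1 :: t.2)
  | Stay => t
  | GoRight => (tape_read t :: t.1, behead t.2)
  end.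

(* The tape alphabet consists of the blank, the two input symbols and finitely
   many auxiliary symbols. *)
Record machine := Machine {
  tapes : nat; (* the machine has tapes.+1 tapes *)
  aux : finType;
  state : finType;
  start : state;
  halting : pred state;
  accepting : pred state;
  transition :
    state -> {ffun 'I_tapes.+1 -> option (bool + aux)} ->
    state * {ffun 'I_tapes.+1 -> option (bool + aux)}
          * ('I_tapes.+1 -> direction) }.

Section Run.
Variable M : machine.

Definition config : Type :=
  (state M * {ffun 'I_(tapes M).+1 -> tape (bool + aux M)})%type.

(* The i-th input word is written on tape i, with the head on its first letter;
   the tapes without input word are blank. *)
Definition init (ws : seq word) : config :=
  (start M, [ffun i : 'I_(tapes M).+1 =>
               ([::], [seq Some (inl b) | b <- nth [::] ws i])]).

Definition step (c : config) : config :=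
  if halting c.1 then c else
  let: (q, a, d) := transition c.1 [ffun i => tape_read (c.2 i)] in
  (q, [ffun i => tape_move (d i) (tape_write (a i) (c.2 i))]).

Definition run (n : nat) (ws : seq word) : config := iter n step (init ws).

Definition halts_in (n : nat) (ws : seq word) : Prop := halting (run n ws).1.

Definition accepts_in (n : nat) (ws : seq word) : Prop :=
  halting (run n ws).1 /\ accepting (run n ws).1.

(* The output is the longest word over {0,1} starting at the head of tape 0. *)
Fixpoint bits_prefix (s : seq (option (bool + aux M))) : word :=
  if s is Some (inl b) :: s' then b :: bits_prefix s' else [::].

Definition output (c : config) : word := bits_prefix (c.2 ord0).2.

End Run.

Definition poly_time_computable (f : word -> word) : Prop :=
  exists (M : machine) (p : {poly nat}), forall x : word,
    halts_in M (horner p (size x)) [:: x] /\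
    output (run M (horner p (size x)) [:: x]) = f x.

(* The verifier M reads the input on tape 0 and the certificate on tape 1. *)
Definition in_NP (L : language) : Prop :=
  exists (M : machine) (p q : {poly nat}), forall x : word,
    (forall w : word, size w <= horner q (size x) ->
       halts_in M (horner p (size x)) [:: x; w]) /\
    (L x <-> exists2 w : word, size w <= horner q (size x) &
       accepts_in M (horner p (size x)) [:: x; w]).

Definition poly_time_reducible (L L' : language) : Prop :=
  exists2 f : word -> word,
    poly_time_computable f & forall x, L x <-> L' (f x).

Definition NP_hard (L : language) : Prop :=
  forall L' : language, in_NP L' -> poly_time_reducible L' L.

Definition NP_complete (L : language) : Prop := in_NP L /\ NP_hard L.

(* Binary expansion, least significant bit first, for 0 < k. *)
Definition binary (k : nat) : word :=
  mkseq (fun i => odd (k %/ 2 ^ i)) (trunc_log 2 k).+1.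

(* The number of vertices in unary, then the adjacency matrix row by row
   (for the enumeration of the vertices given by [enum]), then k in binary. *)
Definition encode (G : sgraph) (k : nat) : word :=
  nseq #|G| true ++ false ::
  [seq edge u v | u <- enum G, v <- enum G] ++ binary k.

(* Words that do not encode a split graph and a positive integer are
   no-instances. *)
Definition split_to_interval (R : realType) : language := fun x =>
  exists (G : sgraph) (k : nat),
    [/\ x = encode G k, split_graph G, 0 < k &
        exists V : {set G}, #|V| <= k /\ interval_graph R (del_vertices V)].

(* Main.v *)
(* Membership. A certificate consists of finitely many binary relations on positions of the
   input: the deleted set, a clique with independent complement, an interval model on
   integer points, and an injection of the deleted set into the numbers below k, where
   being at most k is unfolded along the binary expansion of k. Its validity is a first-order
   property of the input with addition and multiplication of positions.

   Hardness. A split graph is an interval graph iff among the neighbourhoods of its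
   independent vertices no three are pairwise incomparable, that is, iff they fall into two
   chains: the independent vertices on the left and on the right of the point common to the
   clique. Let every clique vertex stand for a pair of values of two variables, placed at
   one variable in the left chain and at the other one in the right chain, in such a way
   that the surviving clique vertices must agree on the value of every variable. With k the
   number of pairs minus the number of constraints, k deletions suffice iff every
   constraint keeps a pair, iff the binary constraint problem is solvable. The
   constraint problem is the computation tableau of the NP verifier. Tapes are indexed by
   the distance to the head, so that moving a head shifts its tape and all constraints relate
   neighbouring cells of a grid.

   The reduction and the verifier are written in a small language of nested loops and
   first-order queries, whose programs run in polynomial time and compile to machines that
   use their tapes as stacks. *)
From mathcomp Require Import all_boot all_order all_algebra.
From mathcomp Require Import reals zify.
Require Import Defs.
From Stdlib Require Import FunctionalExtensionality.

Set Implicit Arguments.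
Unset Strict Implicit.
Unset Printing Implicit Defensive.

Import Order.TTheory GRing.Theory Num.Theory.

(** Three pairwise incomparable neighbourhoods are forbidden and two are not, so a clique vertex can
    make one claim in each chain and no third one. This is why the constraint problem is binary, and
    why each variable has a copy in either chain, the two copies being tied by constraints of their
    own. A transition rule on a window of three cells therefore has to be cut into relations between
    two tiles. In coordinates relative to the heads this works: once the state and the scanned
    letters are repeated in every tile of a row, each half of a new cell depends on a single old
    one.

    Consistency alone only says that at most one pair per constraint survives; it is the exact value
    of k that turns this into one pair for every constraint.

    On the machine side, the verifier and the reduction share one compiler and one time analysis.
    All numbers that a program handles are kept on stacks in unary, so values polynomial in the
    input length cost polynomially many steps. But k, written in binary, may be exponential in the
    length of the input; hence the verifier compares it digit by digit and never computes it. *)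

(** * Stack programs and their machines *)

(* A boolean flag and the letter popped last. *)
Definition ctrl : finType := (bool * option bool)%type.

Definition stacks := nat -> seq bool.

Definition put (st : stacks) i s : stacks := fun j => if j == i then s else st j.

Lemma put_same st i s : put st i s i = s.
Proof. by rewrite /put eqxx. Qed.

Lemma put_other st i j s : j != i -> put st i s j = st j.
Proof. by rewrite /put => /negPf ->. Qed.

Lemma put_put st i s s' : put (put st i s) i s' = put st i s'.
Proof. by apply: functional_extensionality => j; rewrite /put; case: eqP. Qed.

Lemma put_putC st i j s s' :
  i != j -> put (put st i s) j s' = put (put st j s') i s.
Proof.
move=> ij; apply: functional_extensionality => l; rewrite /put.
by case: (l =P j) => // ->; rewrite eq_sym (negPf ij).
Qed.

Lemma put_id st i s : st i = s -> put st i s = st.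
Proof.
by move=> <-; apply: functional_extensionality => j; rewrite /put; case: eqP => // ->.
Qed.

Inductive code :=
| Pop of nat & (ctrl -> option bool -> ctrl)
| Push of nat & (ctrl -> bool)
| Then of code & code
| Cond of (ctrl -> bool) & code & code
| Loop of (ctrl -> bool) & code.

(* The number is the exact number of steps of the machine built from the program:
   Push moves left before it writes, and every test is a step of its own. *)
Inductive exec : code -> ctrl -> stacks -> nat -> ctrl -> stacks -> Prop :=
| ExecPop i g f st :
    exec (Pop i g) f st 1 (g f (ohead (st i))) (put st i (behead (st i)))
| ExecPush i g f st : exec (Push i g) f st 2 f (put st i (g f :: st i))
| ExecThen c1 c2 f st n1 f1 st1 n2 f2 st2 :
    exec c1 f st n1 f1 st1 -> exec c2 f1 st1 n2 f2 st2 ->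
    exec (Then c1 c2) f st (n1 + n2) f2 st2
| ExecCond (b : ctrl -> bool) c1 c2 f st n f' st' :
    exec (if b f then c1 else c2) f st n f' st' ->
    exec (Cond b c1 c2) f st n.+1 f' st'
| ExecLoopF (b : ctrl -> bool) c f st : b f = false -> exec (Loop b c) f st 1 f st
| ExecLoopT (b : ctrl -> bool) c f st n1 f1 st1 n2 f2 st2 :
    b f -> exec c f st n1 f1 st1 -> exec (Loop b c) f1 st1 n2 f2 st2 ->
    exec (Loop b c) f st (n1 + n2).+1 f2 st2.

Fixpoint max_stack (c : code) : nat :=
  match c with
  | Pop i _ | Push i _ => i
  | Then c1 c2 | Cond _ c1 c2 => maxn (max_stack c1) (max_stack c2)
  | Loop _ c => max_stack c
  end.

Fixpoint label (c : code) : finType :=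
  match c with
  | Pop _ _ => unit
  | Push _ _ => bool
  | Then c1 c2 => (label c1 + label c2)%type
  | Cond _ c1 c2 => option (label c1 + label c2)
  | Loop _ c => option (label c)
  end.

Fixpoint entry (c : code) : label c :=
  match c with
  | Pop _ _ => tt
  | Push _ _ => false
  | Then c1 _ => inl (entry c1)
  | Cond _ _ _ => None
  | Loop _ _ => None
  end.

Local Notation action := (option (nat * option bool * direction)).

(** The label [None] marks the exit of a subprogram, and [next] is where the surrounding program
    resumes. *)
Definition relabel (Q Q' : Type) (h : Q -> Q') (next : option Q')
    (r : option Q * ctrl * action) : option Q' * ctrl * action :=
  let: (q, f, a) := r in (if q is Some q' then Some (h q') else next, f, a).

Fixpoint delta (c : code) : label c -> ctrl -> (nat -> option bool) ->
    option (label c) * ctrl * action :=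
  match c return label c -> ctrl -> (nat -> option bool) ->
    option (label c) * ctrl * action with
  | Pop i g => fun _ f rd => (None, g f (rd i), Some (i, None, GoRight))
  | Push i g => fun q f rd =>
      if q then (None, f, Some (i, Some (g f), Stay))
      else (Some true, f, Some (i, rd i, GoLeft))
  | Then c1 c2 => fun q f rd =>
      match q with
      | inl q1 => relabel inl (Some (inr (entry c2))) (delta q1 f rd)
      | inr q2 => relabel inr None (delta q2 f rd)
      end
  | Cond b c1 c2 => fun q f rd =>
      match q with
      | None => (Some (Some (if b f then inl (entry c1) else inr (entry c2))), f, None)
      | Some (inl q1) => relabel (Some \o inl) None (delta q1 f rd)
      | Some (inr q2) => relabel (Some \o inr) None (delta q2 f rd)
      end
  | Loop b c => fun q f rd =>
      match q with
      | None => (if b f then Some (Some (entry c)) else None, f, None)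
      | Some q1 => relabel Some (Some None) (delta q1 f rd)
      end
  end.

Definition sym := option (bool + void).
Definition bit_of (a : sym) : option bool :=
  if a is Some (inl b) then Some b else None.
Definition of_bit (a : option bool) : sym := omap inl a.

Section Simulation.
Variable T : nat.
Implicit Types (c : code) (f : ctrl) (st : stacks).

Definition tapeset := {ffun 'I_T.+1 -> tape (bool + void)}.

Definition written (a : action) (i : nat) (s : sym) : sym :=
  if a is Some (j, b, _) then if i == j then of_bit b else s else s.

Definition moved (a : action) (i : nat) : direction :=
  if a is Some (j, _, d) then if i == j then d else Stay else Stay.

Definition perform (a : action) (tp : tapeset) : tapeset :=
  [ffun i : 'I_T.+1 => tape_move (moved a i) (tape_write (written a i (tape_read (tp i))) (tp i))].

Definition scan (tp : tapeset) (i : nat) : option bool :=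
  bit_of (tape_read (tp (inord i))).

Section Exits.
Variables (Q : Type) (d : Q -> ctrl -> (nat -> option bool) -> option Q * ctrl * action).

Inductive exits : Q -> ctrl -> tapeset -> nat -> ctrl -> tapeset -> Prop :=
| Exit1 q f tp f' a :
    d q f (scan tp) = (None, f', a) -> exits q f tp 1 f' (perform a tp)
| ExitS q f tp q1 f1 a n f' tp' :
    d q f (scan tp) = (Some q1, f1, a) ->
    exits q1 f1 (perform a tp) n f' tp' -> exits q f tp n.+1 f' tp'.
End Exits.

Lemma exits_end (Q Q' : Type) d d' (h : Q -> Q') :
  (forall q f rd, d' (h q) f rd = relabel h None (d q f rd)) ->
  forall q f tp n f' tp', exits d q f tp n f' tp' -> exits d' (h q) f tp n f' tp'.
Proof.
move=> hd q f tp n f' tp'.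
elim=> {q f tp n f' tp'} [q f tp f' a e|q f tp q1 f1 a n f' tp' e _ IH].
  by apply: Exit1; rewrite hd e.
by apply: ExitS IH; rewrite hd e.
Qed.

(** The step that leaves the first part already lands on [q'], so chaining costs nothing and the
    counts in [exec] are exact. *)
Lemma exits_next (Q Q' : Type) d d' (h : Q -> Q') q' :
  (forall q f rd, d' (h q) f rd = relabel h (Some q') (d q f rd)) ->
  forall q f tp n f1 tp1 m f2 tp2, exits d q f tp n f1 tp1 ->
  exits d' q' f1 tp1 m f2 tp2 -> exits d' (h q) f tp (n + m) f2 tp2.
Proof.
move=> hd q f tp n f1 tp1 m f2 tp2 H.
elim: H => {q f tp n f1 tp1} [q f tp f' a e|q f tp q1 f1 a n f' tp' e _ IH] H.
  by apply: ExitS H; rewrite hd e.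
by rewrite addSn; apply: ExitS (IH H); rewrite hd e.
Qed.

Definition blank (s : seq sym) := s = nseq (size s) None.

(* The top of the stack is under the head; popping leaves blanks on the left. *)
Definition holds_stack (s : seq bool) (t : tape (bool + void)) :=
  blank t.1 /\ exists m, t.2 = [seq Some (inl b) | b <- s] ++ nseq m None.

Lemma blank_behead s : blank s -> blank (behead s).
Proof. by rewrite /blank; case: s => //= a s [_ ->]; rewrite size_nseq. Qed.

(** Every step writes on every tape, so an idle tape with an empty stack may gain an explicit blank;
    the trailing blanks in [holds_stack] absorb it. *)
Lemma holds_stack_keep s t :
  holds_stack s t -> holds_stack s (tape_write (tape_read t) t).
Proof.
case: t => l r [/= bl [m ->]]; split=> //=; rewrite /tape_read /=.
by case: s => [|b s] /=; [exists m.-1.+1; case: m | exists m].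
Qed.

Lemma holds_stack_read s t : holds_stack s t -> tape_read t = of_bit (ohead s).
Proof. by case: t => l r [_ [m /= ->]]; case: s => //=; case: m. Qed.

Lemma holds_stack_pop s t :
  holds_stack s t -> holds_stack (behead s) (tape_move GoRight (tape_write None t)).
Proof.
case: t => l r [/= bl [m ->]]; split; first by rewrite /blank /tape_read /= -bl.
by case: s => [|b s] /=; [exists m.-1; case: m | exists m].
Qed.

Lemma holds_stack_push b s t : holds_stack s t ->
  holds_stack (b :: s) (tape_write (Some (inl b))
    (tape_move GoLeft (tape_write (tape_read t) t))).
Proof.
move=> /holds_stack_keep; case: t => l r [/= bl [m e]].
split; first exact: blank_behead.
by exists m; rewrite /= e.
Qed.

Definition represents st (tp : tapeset) := forall i : 'I_T.+1, holds_stack (st i) (tp i).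

Lemma represents_idle st tp : represents st tp -> represents st (perform None tp).
Proof. by move=> H i; rewrite ffunE; apply: holds_stack_keep. Qed.

Lemma scan_represents st tp i :
  represents st tp -> i <= T -> scan tp i = ohead (st i).
Proof.
move=> H iT; rewrite /scan (holds_stack_read (H _)) inordK //.
by case: (ohead _) => [[]|].
Qed.

Lemma simulation c f st n f' st' :
  exec c f st n f' st' -> max_stack c <= T ->
  forall tp, represents st tp ->
  exists2 tp', represents st' tp' & exits (@delta c) (entry c) f tp n f' tp'.
Proof.
elim=> {c f st n f' st'} [i g f st|i g f st|c1 c2 f st n1 f1 st1 n2 f2 st2 _ IH1 _ IH2
  |b c1 c2 f st n f' st' _ IH|b c f st bF|b c f st n1 f1 st1 n2 f2 st2 bT _ IH1 _ IH2] /=.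
- move=> iT tp H.
  have e : delta (c := Pop i g) tt f (scan tp)
      = (None, g f (ohead (st i)), Some (i, None, GoRight)).
    by rewrite /= (scan_represents H iT).
  eexists; last exact: Exit1 e.
  move=> j; rewrite ffunE /put /=; case: eqP => [<-|_].
    exact: holds_stack_pop (H j).
  exact: holds_stack_keep (H j).
- move=> iT tp H; eexists; last first.
    by apply: (@ExitS _ _ _ _ _ true f); [reflexivity|apply: Exit1; reflexivity].
  move=> j; rewrite !ffunE /put /= (scan_represents H iT).
  case: eqP => [e|_]; last by do 2!apply: holds_stack_keep.
  rewrite -e -(holds_stack_read (H j)).
  exact: holds_stack_push.
- rewrite geq_max => /andP[T1 T2] tp H.
  have [tp1 H1 E1] := IH1 T1 tp H; have [tp2 H2 E2] := IH2 T2 tp1 H1.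
  exists tp2 => //; apply: (exits_next _ E1) => //.
  exact: (exits_end _ E2).
- rewrite geq_max => /andP[T1 T2] tp H.
  have [|tp' H' E] := IH _ (perform None tp) (represents_idle H); first by case: ifP.
  exists tp' => //; apply: ExitS; first by [].
  by case: (b f) E => E; apply: (exits_end (h := Some \o _) _ E).
- move=> cT tp H; exists (perform None tp); first exact: represents_idle.
  by apply: Exit1; rewrite /= bF.
- move=> cT tp H.
  have [tp1 H1 E1] := IH1 cT _ (represents_idle H); have [tp2 H2 E2] := IH2 cT tp1 H1.
  exists tp2 => //; apply: ExitS; first by rewrite /= bT.
  exact: (exits_next _ E1).
Qed.

End Simulation.

(** Leaving the program means halting, and the flag is then the verdict; it starts as [true], which
    is what [exec_cmd] assumes. *)
Definition code_machine (T : nat) (c : code) : machine :=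
  @Machine T void (option (label c) * ctrl)%type (Some (entry c), (true, None))
    (fun q => q.1 == None) (fun q => q.2.1)
    (fun q rd =>
       if q.1 is Some l then
         let: (l', f', a) := delta l q.2 (fun i => bit_of (rd (inord i))) in
         ((l', f'), [ffun i : 'I_T.+1 => written a i (rd i)], fun i : 'I_T.+1 => moved a i)
       else (q, rd, fun=> Stay)).

Lemma code_machine_exits T c l f tp n f' tp' :
  @exits T _ (@delta c) l f tp n f' tp' ->
  iter n (@step (code_machine T c)) ((Some l, f), tp) = ((None, f'), tp').
Proof.
have step1 q g (t : tapeset T) : @step (code_machine T c) ((Some q, g), t) =
    let: (l', g', a) := delta q g (scan t) in ((l', g'), perform a t).
  have e : (fun i => bit_of ([ffun i : 'I_T.+1 => tape_read (t i)] (inord i))) = scan t.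
    by apply: functional_extensionality => i; rewrite ffunE.
  rewrite /step /= e; case: (delta q g (scan t)) => [[l' g'] a].
  by congr (_, _); apply/ffunP => i; rewrite !ffunE.
elim=> {l f tp n f' tp'} [q g t g' a e|q g t q1 g1 a n f' tp' e _ IH].
  by rewrite /= step1 e.
by rewrite iterSr step1 e IH.
Qed.

Lemma step_halted (M : machine) n (c : config M) : halting c.1 -> iter n (@step M) c = c.
Proof. by move=> h; elim: n => //= n ->; rewrite /step h. Qed.

Lemma code_machine_run (c : code) (ws : seq word) n f st' m T :
  max_stack c <= T -> n <= m ->
  exec c (true, None) (fun i => nth [::] ws i) n f st' ->
  exists2 tp, represents st' tp & run (code_machine T c) m ws = ((None, f), tp).
Proof.
move=> cT nm E.
pose tp0 : tapeset T := (init (code_machine T c) ws).2.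
have H0 : represents (fun i => nth [::] ws i) tp0.
  by move=> i; rewrite ffunE; split=> //=; exists 0; rewrite cats0.
have [tp H X] := simulation E cT H0.
exists tp => //; rewrite /run -(subnK nm) iterD.
have -> : init (code_machine T c) ws = ((Some (entry c), (true, None)), tp0) by [].
by rewrite (code_machine_exits X) step_halted.
Qed.

(** * A language for logarithmic space *)

(** With a base of at least 2, constants and sums are absorbed by a larger exponent, so a single
    power is closed under all operations below. *)
Definition poly_bounded (f : nat -> nat) := exists D, forall B, f B <= B.+2 ^ D.

Lemma poly_bounded_const c : poly_bounded (fun=> c).
Proof.
exists c => B; case: c => // c.
by apply: leq_trans (ltnW (ltn_expl _ (isT : 1 < 2))) _; rewrite leq_exp2r.
Qed.

Lemma poly_bounded_id : poly_bounded id.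
Proof. by exists 1 => B; rewrite expn1; lia. Qed.

Lemma poly_bounded_add f g :
  poly_bounded f -> poly_bounded g -> poly_bounded (fun B => f B + g B).
Proof.
move=> [a Ha] [b Hb]; exists (a + b).+1 => B.
have a1 : 1 <= B.+2 ^ a by rewrite expn_gt0.
have b1 : 1 <= B.+2 ^ b by rewrite expn_gt0.
have := Ha B; have := Hb B; rewrite expnS expnD; nia.
Qed.

Lemma poly_bounded_succ f : poly_bounded f -> poly_bounded (fun B => (f B).+1).
Proof.
move=> Pf; have [D HD] := poly_bounded_add Pf (poly_bounded_const 1).
by exists D => B; rewrite -addn1.
Qed.

Lemma poly_bounded_mul f g :
  poly_bounded f -> poly_bounded g -> poly_bounded (fun B => f B * g B).
Proof.
by move=> [a Ha] [b Hb]; exists (a + b) => B; rewrite expnD leq_mul.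
Qed.

Lemma poly_bounded_comp f g :
  poly_bounded f -> poly_bounded g -> poly_bounded (fun B => f (g B)).
Proof.
move=> [a Ha] [b Hb]; exists (b.+2 * a) => B; apply: leq_trans (Ha _) _.
case: a {Ha} => [|a]; first by rewrite muln0.
rewrite expnM leq_exp2r //.
have b1 : 1 <= B.+2 ^ b by rewrite expn_gt0.
by have := Hb B; rewrite !expnS; nia.
Qed.

Lemma horner_poly_bounded (p : {poly nat}) : poly_bounded (fun n => p.[n])%R.
Proof.
elim/poly_ind: p => [|p c IH].
  by exists 0 => B; rewrite horner0.
have [D HD] := poly_bounded_add (poly_bounded_mul IH poly_bounded_id) (poly_bounded_const c).
by exists D => B; rewrite hornerMXaddC; apply: HD.
Qed.

(* A variable [Var i] is the i-th entry of the environment, a list of numbers to which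
   [FEx] and [For] append the bound variable. [Len w] and [FBit w] refer to the input word
   on tape [w]. *)
Inductive expr :=
| Var of nat
| Num of nat
| Len of bool
| Add of expr & expr
| Mul of expr & expr.

Inductive formula :=
| FConst of bool
| FLt of expr & expr
| FBit of bool & expr
| FNot of formula
| FAnd of formula & formula
| FEx of expr & formula.

Inductive cmd :=
| Skip
| Out of formula
| Seq of cmd & cmd
| For of expr & cmd
| OutBin of expr.

Section Semantics.
Variable ws : seq word.
Implicit Types env : seq nat.

Definition input (w : bool) : word := nth [::] ws w.

Fixpoint value env (e : expr) : nat :=
  match e with
  | Var i => nth 0 env i
  | Num n => n
  | Len w => size (input w)
  | Add e1 e2 => value env e1 + value env e2
  | Mul e1 e2 => value env e1 * value env e2
  end.

Fixpoint holds env (phi : formula) : bool :=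
  match phi with
  | FConst b => b
  | FLt e1 e2 => value env e1 < value env e2
  | FBit w e => nth false (input w) (value env e)
  | FNot phi => ~~ holds env phi
  | FAnd phi psi => holds env phi && holds env psi
  | FEx e phi => has (fun n => holds (rcons env n) phi) (iota 0 (value env e))
  end.

Definition bits n : word := if n is 0 then [::] else binary n.

Fixpoint emits env (c : cmd) : word :=
  match c with
  | Skip => [::]
  | Out phi => [:: holds env phi]
  | Seq c1 c2 => emits env c1 ++ emits env c2
  | For e c => flatten [seq emits (rcons env n) c | n <- iota 0 (value env e)]
  | OutBin e => bits (value env e)
  end.

End Semantics.

Lemma bits_half n : 0 < n -> bits n = odd n :: bits n./2.
Proof.
case: n => // -[|n] // _; rewrite -[_./2]/(n./2.+1) /bits /binary trunc_log2S //.
rewrite -[_./2]/(n./2.+1) /mkseq -[iota 0 _.+2]/(0 :: iota (1 + 0) _.+1) iotaDl.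
rewrite map_cons -map_comp divn1; congr (_ :: _); apply: eq_map => i /=.
by rewrite expnS divnMA divn2.
Qed.

(** * Compilation of the language to stack programs *)

Definition loaded (f : ctrl) := isSome f.2.
Definition loaded_bit (f : ctrl) := odflt true f.2.
Definition skip := Loop (fun=> false) (Pop 0 (fun f _ => f)).
Definition load i := Pop i (fun f a => (f.1, a)).
(** The body may destroy the loaded letter, since the closing [load] replaces it before the next
    test. Loops can thus be nested without saving it. *)
Definition drain i c := Then (load i) (Loop loaded (Then c (load i))).
Definition transfer i j := drain i (Push j loaded_bit).
Definition copy_size i j :=
  Then (drain i (Then (Push j (fun=> true)) (Push 3 loaded_bit))) (transfer 3 i).

(* Stacks 0 and 1 hold the inputs, 2 the output, 3 is scratch space, and 4 + i holds the
   i-th entry of the environment in unary; [k] is the length of the environment.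
   [expr_code] pushes the value of [e] onto stack [d], with free stacks from [s] on. *)
Fixpoint expr_code e k d s :=
  match e with
  | Var i => if i < k then copy_size (4 + i) d else skip
  | Num n => iter n (Then (Push d (fun=> true))) skip
  | Len w => copy_size w d
  | Add e1 e2 => Then (expr_code e1 k d s) (expr_code e2 k d s)
  | Mul e1 e2 => Then (expr_code e1 k s s.+1) (drain s (expr_code e2 k d s.+1))
  end.

(** The stack that counts the rounds of a quantifier is itself the stack of the bound variable: once
    a letter is popped, its height runs from the bound minus one down to 0. *)
Fixpoint formula_code phi k :=
  let d := 4 + k in
  match phi with
  | FConst b => Pop 3 (fun f _ => (b, f.2))
  | FLt e1 e2 =>
      Then (expr_code e1 k d d.+1) (Then (expr_code e2 k d.+1 d.+2)
        (Then (drain d (Pop d.+1 (fun f _ => f)))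
          (Then (Pop d.+1 (fun f a => (isSome a, f.2))) (drain d.+1 skip))))
  | FBit w e =>
      Then (expr_code e k d d.+1)
        (Then (drain d (Then (load w) (Cond loaded (Push 3 loaded_bit) skip)))
          (Then (Then (Pop w (fun _ a => (a == Some true, a)))
              (Cond loaded (Push w loaded_bit) skip)) (transfer 3 w)))
  | FNot phi => Then (formula_code phi k) (Pop 3 (fun f _ => (~~ f.1, f.2)))
  | FAnd phi psi => Then (formula_code phi k) (Cond fst (formula_code psi k) skip)
  | FEx e phi =>
      Then (expr_code e k d d.+1) (Then (Pop 3 (fun f _ => (false, f.2)))
        (drain d (Cond fst skip (formula_code phi k.+1))))
  end.

(* Moves every second letter of stack [d] to the next stack; the flag is the parity. *)
Definition halve d :=
  Then (Pop d.+2 (fun f _ => (false, f.2)))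
    (drain d (Then (Cond fst (Push d.+1 (fun=> true)) skip)
                   (Pop d.+2 (fun f _ => (~~ f.1, f.2))))).

(** The letter popped for the test is pushed back before halving. Stack 3 collects the digits with
    the most significant one on top, and the final transfer turns them into the order of
    [binary]. *)
Definition binary_code d :=
  Then (load d) (Then
    (Loop loaded (Then (Push d loaded_bit) (Then (halve d) (Then (Push 3 fst)
       (Then (transfer d.+1 d) (load d))))))
    (transfer 3 2)).

(** Restoring a fixed flag after each output lets the loops of [cmd_code] be analysed with a
    constant [h] in [exec_drain]. *)
Definition reset_flag := Pop 3 (fun f _ => (true, f.2)).

(* The output is pushed onto a stack, so the last part of it comes first: sequences run
   from right to left and loops downwards. *)
Fixpoint cmd_code c k :=
  let d := 4 + k in
  match c with
  | Skip => skip
  | Out phi => Then (Then (formula_code phi k) (Push 2 fst)) reset_flag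
  | Seq c1 c2 => Then (cmd_code c2 k) (cmd_code c1 k)
  | For e c => Then (expr_code e k d d.+1) (drain d (cmd_code c k.+1))
  | OutBin e => Then (Then (expr_code e k d d.+1) (binary_code d)) reset_flag
  end.

(** * Correctness and step bounds of the compiled programs *)

Section Drain.
Variables (A : Type) (next : A -> bool -> seq bool -> A).

Fixpoint drained x s := if s is a :: s' then drained (next x a s') s' else x.

(** The invariant rule for loops: [x] is the abstract loop state, [G] and [h] give the stacks and
    the flag that it stands for, [next] is one round, and [W] holds of the rest of the counting
    stack. A round costs the body, a load and a test. *)
Lemma exec_drain (G : A -> stacks) (h : A -> bool) (W : seq bool -> Prop) i c K :
  (forall a s, W (a :: s) -> W s) ->
  (forall x a s, W (a :: s) -> exists n r, n <= K /\
     exec c (h x, Some a) (put (G x) i s) n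
       (h (next x a s), r) (put (G (next x a s)) i s)) ->
  forall s x r, W s -> exists n, n <= (size s).+1 * (K + 3) /\
    exec (drain i c) (h x, r) (put (G x) i s) n
      (h (drained x s), None) (put (G (drained x s)) i [::]).
Proof.
move=> Wtl Hc s x r Ws.
suff [n [Hn E]] : exists n, n <= (size s).+1 * (K + 3) - 1 /\
    exec (Loop loaded (Then c (load i))) (h x, ohead s) (put (G x) i (behead s)) n
      (h (drained x s), None) (put (G (drained x s)) i [::]).
  exists (1 + n); split; first by rewrite mulSn in Hn *; lia.
  apply: ExecThen E.
  have := ExecPop i (fun f a => (f.1, a)) (h x, r) (put (G x) i s).
  by rewrite put_same put_put.
elim: s x {r} Ws => [|a s IH] x Ws /=.
  by exists 1; split; [lia | apply: ExecLoopF].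
have [n1 [r [Hn1 E1]]] := Hc x a s Ws.
have [n2 [Hn2 E2]] := IH (next x a s) (Wtl _ _ Ws).
exists (n1 + 1 + n2).+1; split; first by rewrite mulSn in Hn2 *; lia.
apply: ExecLoopT E2 => //; apply: ExecThen E1 _.
have := ExecPop i (fun f a => (f.1, a)) (h (next x a s), r) (put (G (next x a s)) i s).
by rewrite put_same put_put.
Qed.

End Drain.

Ltac put_ext :=
  apply: functional_extensionality => ?; rewrite /put;
  repeat case: eqP => ?; subst; rewrite ?eqxx //; try congruence; try lia.

Lemma exec_skip f st : exec skip f st 1 f st.
Proof. exact: ExecLoopF. Qed.

Lemma exec_transfer i j st b r : i != j ->
  exists n, n <= (size (st i)).+1 * 5 /\
    exec (transfer i j) (b, r) st n (b, None) (put (put st j (catrev (st i) (st j))) i [::]).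
Proof.
move=> /eqP ij.
have [|x a s _|n [Hn E]] := @exec_drain _ (fun x a _ => a :: x) (put st j) (fun=> b)
  (fun=> True) i (Push j loaded_bit) 2 _ _ (st i) (st j) r I; first by [].
  exists 2, (Some a); split=> //.
  have := ExecPush j loaded_bit (b, Some a) (put (put st j x) i s).
  have -> : put (put st j x) i s j = x by rewrite /put eqxx; case: eqP => //; lia.
  suff -> : put (put (put st j x) i s) j (loaded_bit (b, Some a) :: x)
          = put (put st j (a :: x)) i s by [].
  by put_ext.
exists n; split=> //; move: E.
have -> : put (put st j (st j)) i (st i) = st by put_ext.
suff -> : forall s t, drained (fun x a _ => a :: x) t s = catrev s t by [].
by elim=> //= a s IH t; rewrite IH.
Qed.

Lemma exec_copy_size i j st b r : i != j -> i != 3 -> j != 3 -> st 3 = [::] ->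
  exists n, n <= (size (st i)).+1 * 13 /\
    exec (copy_size i j) (b, r) st n (b, None) (put st j (nseq (size (st i)) true ++ st j)).
Proof.
move=> /eqP ij /eqP i3 /eqP j3 st3.
pose G x := put (put st j x.1) 3 x.2.
pose next (x : seq bool * seq bool) a (_ : seq bool) := (true :: x.1, a :: x.2).
have [|x a s _|n [Hn E]] := @exec_drain _ next G (fun=> b)
  (fun=> True) i (Then (Push j (fun=> true)) (Push 3 loaded_bit)) 4 _ _
  (st i) (st j, [::]) r I; first by [].
  exists (2 + 2), (Some a); split=> //.
  apply: ExecThen; first exact: ExecPush.
  have := ExecPush 3 loaded_bit (b, Some a) (put (put (G x) i s) j (true :: x.1)).
  have -> : put (G x) i s j = x.1 by rewrite /G /put eqxx; repeat case: eqP => //; lia.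
  have -> : put (put (G x) i s) j (true :: x.1) 3 = x.2.
    by rewrite /G /put eqxx; repeat case: eqP => //; lia.
  suff -> : put (put (put (G x) i s) j (true :: x.1)) 3 (loaded_bit (b, Some a) :: x.2)
          = put (G (next x a s)) i s by [].
  by rewrite /G /next; put_ext.
have e1 : put (G (st j, [::])) i (st i) = st by rewrite /G; put_ext.
have e2 : forall s t u, drained next (t, u) s = (nseq (size s) true ++ t, catrev s u).
  elim=> //= a s IH t u; rewrite IH /=; congr (_, _).
  by elim: (size s) => //= m ->.
rewrite e1 e2 in E; set st' := put _ _ _ in E.
have i3' : 3 != i by apply/eqP => e; apply: i3.
have [m [Hm E']] := exec_transfer st' b None i3'.
have e3 : st' 3 = rev (st i) by rewrite /st' /G /put eqxx; case: eqP => // /esym/i3.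
have e4 : st' i = [::] by rewrite /st' put_same.
exists (n + m); split.
  by rewrite e3 size_rev in Hm; lia.
apply: ExecThen E _; move: E'; rewrite e3 e4 catrevE cats0 revK.
suff -> : put (put st' i (st i)) 3 [::]
  = put st j (nseq (size (st i)) true ++ st j) by [].
by rewrite /st' /G /=; put_ext.
Qed.

(** The invariant between compiled pieces. Stack 2 is left out because the output accumulates there,
    and stacks below [s] may hold temporaries. *)
Record frame ws env s (st : stacks) : Prop := Frame {
  frame_input : forall w : bool, st w = input ws w;
  frame_tmp : st 3 = [::];
  frame_env : forall i, i < size env -> st (4 + i) = nseq (nth 0 env i) true;
  frame_free : forall i, s <= i -> st i = [::] }.

Lemma frame_put ws env s s' d st u :
  frame ws env s st -> 4 + size env <= d < s' -> s <= s' -> frame ws env s' (put st d u).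
Proof.
move=> [Fi Ft Fe Ff] /andP[kd ds] ss; split.
- by move=> w; rewrite put_other ?Fi //; case: w; lia.
- by rewrite put_other //; lia.
- by move=> i ik; rewrite put_other ?Fe //; lia.
- by move=> i si; rewrite put_other ?Ff //; lia.
Qed.

Lemma frame_rcons ws env st m :
  frame ws env (4 + size env) st ->
  frame ws (rcons env m) (4 + size (rcons env m)) (put st (4 + size env) (nseq m true)).
Proof.
move=> F; have [Fi Ft Fe Ff] := F; rewrite size_rcons; split.
- by move=> w; rewrite put_other ?Fi //; case: w; lia.
- by rewrite put_other //; lia.
- move=> i; rewrite size_rcons ltnS nth_rcons => ik.
  case: ltnP => ik'; first by rewrite put_other ?Fe //; lia.
  have -> : i = size env by lia.
  by rewrite eqxx put_same.
- by move=> i si; rewrite put_other ?Ff //; lia.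
Qed.

Definition bounded ws env B :=
  (forall w, size (input ws w) <= B) /\ (forall i, nth 0 env i <= B).

Lemma value_bounded e : exists2 V, poly_bounded V &
  forall ws env B, bounded ws env B -> value ws env e <= V B.
Proof.
elim: e => [i|n|w|e1 [V1 P1 H1] e2 [V2 P2 H2]|e1 [V1 P1 H1] e2 [V2 P2 H2]] /=.
- by exists id; [exact: poly_bounded_id|move=> ws env B []].
- by exists (fun=> n); [exact: poly_bounded_const|].
- by exists id; [exact: poly_bounded_id|move=> ws env B []].
- exists (fun B => V1 B + V2 B); first exact: poly_bounded_add.
  by move=> ws env B HB; rewrite leq_add ?H1 ?H2.
- exists (fun B => V1 B * V2 B); first exact: poly_bounded_mul.
  by move=> ws env B HB; rewrite leq_mul ?H1 ?H2.
Qed.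

Lemma poly_bounded_linear a f : poly_bounded f -> poly_bounded (fun B => (f B).+1 * a).
Proof.
by move=> Pf; apply: poly_bounded_mul (poly_bounded_const a); apply: poly_bounded_succ.
Qed.

Definition unary (s : seq bool) := s = nseq (size s) true.

Lemma unary_behead a s : unary (a :: s) -> unary s.
Proof. by case. Qed.

Lemma unary_nseq n : unary (nseq n true).
Proof. by rewrite /unary size_nseq. Qed.

Lemma put_cat_nseq st d m n :
  put (put st d (nseq m true ++ st d)) d (nseq n true ++ put st d (nseq m true ++ st d) d)
  = put st d (nseq (m + n) true ++ st d).
Proof. by rewrite put_put put_same catA -nseqD addnC. Qed.

(** The value goes on top of what [d] already holds, so [Add] is mere sequencing and [Mul] pushes
    its second factor once per unit of the first. *)
Lemma exec_expr e : exists2 K, poly_bounded K &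
  forall ws env B s d st b r, bounded ws env B -> frame ws env s st ->
  4 + size env <= d < s -> exists n r', n <= K B /\
    exec (expr_code e (size env) d s) (b, r) st n
      (b, r') (put st d (nseq (value ws env e) true ++ st d)).
Proof.
elim: e => [i|m|w|e1 [K1 P1 H1] e2 [K2 P2 H2]|e1 [K1 P1 H1] e2 [K2 P2 H2]].
- exists (fun B => B.+1 * 13); first exact: poly_bounded_linear poly_bounded_id.
  move=> ws env B s d st b r [_ HB] F ds /=.
  case: ltnP => ik; last first.
    by exists 1, r; split; [lia|rewrite nth_default // put_id //; exact: exec_skip].
  have [|||n [Hn E]] := @exec_copy_size (4 + i) d st b r _ _ _ (frame_tmp F); try lia.
  exists n, None; split; last by rewrite (frame_env F ik) size_nseq in E.
  by rewrite (frame_env F ik) size_nseq in Hn; have := HB i; nia.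
- exists (fun=> m.+1 * 2); first exact: poly_bounded_const.
  move=> ws env B s d st b r _ _ _ /=.
  elim: m st => [|m IH] st /=.
    by exists 1, r; split=> //; rewrite put_id //; exact: exec_skip.
  have [n [r' [Hn E]]] := IH (put st d (true :: st d)).
  exists (2 + n), r'; split; first lia.
  apply: ExecThen; first exact: ExecPush.
  move: E; rewrite put_put put_same.
  suff -> : nseq m true ++ true :: st d = true :: nseq m true ++ st d by [].
  by elim: (m) => //= ? ->.
- exists (fun B => B.+1 * 13); first exact: poly_bounded_linear poly_bounded_id.
  move=> ws env B s d st b r [HB _] F ds /=.
  have [|||n [Hn E]] := @exec_copy_size w d st b r _ _ _ (frame_tmp F);
    try by case: w; lia.
  exists n, None; split; last by rewrite (frame_input F) in E.
  by rewrite (frame_input F) in Hn; have := HB w; nia.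
- exists (fun B => K1 B + K2 B); first exact: poly_bounded_add.
  move=> ws env B s d st b r HB F ds /=.
  have [n1 [r1 [Hn1 E1]]] := H1 _ _ _ _ _ _ b r HB F ds.
  have [n2 [r2 [Hn2 E2]]] := H2 _ _ _ s d _ b r1 HB
    (frame_put (nseq (value ws env e1) true ++ st d) F ds (leqnn _)) ds.
  exists (n1 + n2), r2; split; first lia.
  by rewrite -put_cat_nseq; apply: ExecThen E1 E2.
- have [V PV HV] := value_bounded e1.
  exists (fun B => K1 B + (V B).+1 * (K2 B + 3)).
    apply: poly_bounded_add => //; apply: (poly_bounded_mul (f := fun B => (V B).+1)).
      exact: poly_bounded_succ.
    exact: poly_bounded_add (poly_bounded_const 3).
  move=> ws env B s d st b r HB F ds /=.
  have F1 : frame ws env s.+1 st.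
    by case: F => ? ? ? Ff; split=> // i si; apply: Ff; lia.
  have [|n1 [r1 [Hn1 E1]]] := H1 _ _ _ _ s _ b r HB F1; first by lia.
  pose next (x : seq bool) (_ : bool) (_ : seq bool) := nseq (value ws env e2) true ++ x.
  have [|x a u Wu|n2 [Hn2 E2]] := @exec_drain _ next (put st d) (fun=> b) unary s
    (expr_code e2 (size env) d s.+1) (K2 B) _ _ (nseq (value ws env e1) true) (st d) r1
    (unary_nseq _); first exact: unary_behead.
    have Fx : frame ws env s.+1 (put (put st d x) s u).
      by apply: frame_put (leqnSn _); [exact: frame_put F ds _|lia].
    have [|n [r' [Hn E]]] := H2 _ _ _ s.+1 d _ b (Some a) HB Fx; first by lia.
    exists n, r'; split=> //; rewrite /next; move: E.
    have -> : put (put st d x) s u d = x by rewrite /put eqxx; case: eqP => //; lia.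
    suff -> : forall y, put (put (put st d x) s u) d y = put (put st d y) s u by [].
    by move=> y; put_ext.
  exists (n1 + n2), None; split.
    rewrite size_nseq in Hn2; have := HV _ _ _ HB; nia.
  have ss : st s = [::] by apply: (frame_free F).
  rewrite ss cats0 in E1; apply: ExecThen E1 _.
  move: E2.
  have -> : put (put st d (st d)) s (nseq (value ws env e1) true)
    = put st s (nseq (value ws env e1) true) by rewrite (put_id (erefl (st d))).
  have -> : forall m x, drained next x (nseq m true) = nseq (m * value ws env e2) true ++ x.
    by elim=> //= m IH x; rewrite IH /next catA -nseqD mulSn addnC.
  suff -> : forall u, put (put st d u) s [::] = put st d u by [].
  by move=> u; rewrite put_id // put_other //; lia.
Qed.

Lemma exec_set g f st i : st i = [::] -> exec (Pop i (fun f _ => g f)) f st 1 (g f) st.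
Proof.
move=> e; have := ExecPop i (fun f _ => g f) f st.
by rewrite e put_id.
Qed.

Lemma exec_clear i st b r :
  exists n, n <= (size (st i)).+1 * 4 /\
    exec (drain i skip) (b, r) st n (b, None) (put st i [::]).
Proof.
have [|_ a s _|n [Hn E]] := @exec_drain _ (fun x _ _ => x) (fun _ : unit => st) (fun=> b)
  (fun=> True) i skip 1 _ _ (st i) tt r I; first by [].
  by exists 1, (Some a); split=> //; exact: exec_skip.
by exists n; split=> //; move: E; rewrite put_id.
Qed.

Lemma bounded_rcons ws env B m V :
  bounded ws env B -> m <= V -> bounded ws (rcons env m) (B + V).
Proof.
move=> [Hi He] mV; split=> [w|i]; first exact: leq_trans (Hi w) (leq_addr _ _).
rewrite nth_rcons; case: ifP => _; first exact: leq_trans (He i) (leq_addr _ _).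
by case: ifP => // _; apply: leq_trans mV (leq_addl _ _).
Qed.

Lemma frame_weaken ws env s s' st : frame ws env s st -> s <= s' -> frame ws env s' st.
Proof. by case=> ? ? ? Ff ss; split=> // i si; apply: Ff; apply: leq_trans si. Qed.

Lemma exec_expr_free e : exists2 K, poly_bounded K &
  forall ws env B s d st b r, bounded ws env B -> frame ws env d st ->
  4 + size env <= d < s -> exists n r', n <= K B /\
    exec (expr_code e (size env) d s) (b, r) st n
      (b, r') (put st d (nseq (value ws env e) true)).
Proof.
have [K PK HK] := exec_expr e; exists K => // ws env B s d st b r HB F ds.
have [|n [r' [Hn E]]] := HK ws env B s d st b r HB _ ds.
  by apply: frame_weaken F _; lia.
by exists n, r'; split=> //; move: E; rewrite (frame_free F) // cats0.
Qed.

(** Truncated subtraction: every unit of [e1] pops one from the stack of [e2], and a letter is left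
    over iff the inequality holds. *)
Lemma exec_lt e1 e2 : exists2 K, poly_bounded K &
  forall ws env B st b r, bounded ws env B -> frame ws env (4 + size env) st ->
  exists n r', n <= K B /\ exec (formula_code (FLt e1 e2) (size env)) (b, r) st n
    (value ws env e1 < value ws env e2, r') st.
Proof.
have [K1 P1 H1] := exec_expr_free e1; have [K2 P2 H2] := exec_expr_free e2.
have [V1 PV1 HV1] := value_bounded e1; have [V2 PV2 HV2] := value_bounded e2.
exists (fun B => K1 B + (K2 B + ((V1 B).+1 * 4 + (1 + (V2 B).+1 * 4)))).
  do 4?apply: poly_bounded_add => //; do ?exact: poly_bounded_linear.
  exact: poly_bounded_const.
move=> ws env B st b r HB F; rewrite /=; set d := 4 + size env in F *.
have := HV1 _ _ _ HB; have := HV2 _ _ _ HB.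
move: (H1 ws env) (H2 ws env); set v1 := value _ _ e1; set v2 := value _ _ e2.
move=> {}H1 {}H2 Hv2 Hv1.
have [|n1 [r1 [Hn1 E1]]] := H1 B d.+1 d st b r HB F; first by rewrite leqnn ltnSn.
have [||n2 [r2 [Hn2 E2]]] := H2 B d.+2 d.+1 (put st d (nseq v1 true)) b r1 HB.
- by apply: frame_put F _ _; rewrite ?leqnn.
- by rewrite ltnSn leqnSn.
have [|x a s _|n3 [Hn3 E3]] := @exec_drain _ (fun x _ _ => behead x) (put st d.+1) (fun=> b)
  (fun=> True) d (Pop d.+1 (fun f _ => f)) 1 _ _ (nseq v1 true) (nseq v2 true) r2 I.
- by [].
- exists 1, (Some a); split=> //.
  have := ExecPop d.+1 (fun f _ => f) (b, Some a) (put (put st d.+1 x) d s).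
  suff -> : put (put (put st d.+1 x) d s) d.+1 (behead (put (put st d.+1 x) d s d.+1))
    = put (put st d.+1 (behead x)) d s by [].
  by put_ext; rewrite put_other ?put_same //; lia.
have e3 : forall u m, drained (fun (x : seq bool) _ _ => behead x) u (nseq m true) = drop m u.
  move=> u m; elim: m u => [|m IH] u /=; first by rewrite drop0.
  by rewrite IH; case: u.
rewrite {}e3 drop_nseq in E3; set st3 := put (put st _ _) d [::] in E3.
have E4 := ExecPop d.+1 (fun f a => (isSome a, f.2)) (b, None) st3.
have e4 : st3 d.+1 = nseq (v2 - v1) true by rewrite /st3 put_other ?put_same //; lia.
rewrite e4 in E4; set st4 := put _ _ _ in E4.
have [n5 [Hn5 E5]] := exec_clear d.+1 st4 (isSome (ohead (nseq (v2 - v1) true))) None.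
exists (n1 + (n2 + (n3 + (1 + n5)))), None; split.
  have : size (st4 d.+1) <= v2 by rewrite /st4 put_same size_behead size_nseq; lia.
  by rewrite size_nseq in Hn3 *; nia.
have -> : (v1 < v2) = isSome (ohead (nseq (v2 - v1) true)).
  by rewrite -subn_gt0; case: (v2 - v1).
rewrite put_putC in E3; last by lia.
apply: ExecThen E1 _; apply: ExecThen E2 _; apply: ExecThen E3 _.
apply: ExecThen E4 _; move: E5.
suff -> : put st4 d.+1 [::] = st by [].
rewrite /st4 /st3; put_ext; rewrite (frame_free F) //; lia.
Qed.

(** The letters in front of the position are parked on stack 3 and moved back afterwards. Popping an
    exhausted input yields no letter, which agrees with the default [false] of [nth]. *)
Lemma exec_bit w e : exists2 K, poly_bounded K &
  forall ws env B st b r, bounded ws env B -> frame ws env (4 + size env) st ->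
  exists n r', n <= K B /\ exec (formula_code (FBit w e) (size env)) (b, r) st n
    (nth false (input ws w) (value ws env e), r') st.
Proof.
have [K PK HK] := exec_expr_free e; have [V PV HV] := value_bounded e.
exists (fun B => K B + ((V B).+1 * 7 + (4 + B.+1 * 5))).
  do 3?apply: poly_bounded_add => //; do ?exact: poly_bounded_linear.
    exact: poly_bounded_const.
  exact: poly_bounded_linear poly_bounded_id.
move=> ws env B st b r HB F /=; set d := 4 + size env in F *.
have w3 : nat_of_bool w != 3 by case: (w).
have wd : nat_of_bool w != d by case: (w); rewrite /d; lia.
have d3 : d != 3 by rewrite /d; lia.
have := HV _ _ _ HB; move: (HK ws env); set v := value _ _ e => {}HK Hv.
have Hu := HB.1 w; have eu := frame_input F w; set u := input ws w in Hu eu *.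
have [|n1 [r1 [Hn1 E1]]] := HK B d.+1 d st b r HB F; first by rewrite leqnn ltnSn.
pose next (x : seq bool * seq bool) (_ : bool) (_ : seq bool) :=
  if x.1 is a :: s then (s, a :: x.2) else x.
pose G x := put (put st w x.1) 3 x.2.
have [|x a s _|n2 [Hn2 E2]] := @exec_drain _ next G (fun=> b) (fun=> True) d
  (Then (load w) (Cond loaded (Push 3 loaded_bit) skip)) 4 _ _ (nseq v true) (u, [::]) r1 I.
- by [].
- have E := ExecPop w (fun f a => (f.1, a)) (b, Some a) (put (G x) d s).
  have ex : put (G x) d s w = x.1.
    by rewrite /G put_other // put_other // put_same.
  rewrite ex in E; case: x ex E => [[|c x1] x2] /= ex E.
    exists (1 + 2), None; split=> //; apply: ExecThen E _.
    suff -> : put (put (G ([::], x2)) d s) w [::] = put (G ([::], x2)) d s.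
      by apply: ExecCond; exact: exec_skip.
    by rewrite put_id.
  exists (1 + 3), (Some c); split=> //; apply: ExecThen E _; apply: ExecCond.
  have := ExecPush 3 loaded_bit (b, Some c) (put (put (G (c :: x1, x2)) d s) w x1).
  suff -> : put (put (put (G (c :: x1, x2)) d s) w x1) 3 (loaded_bit (b, Some c)
      :: put (put (G (c :: x1, x2)) d s) w x1 3) = put (G (next (c :: x1, x2) a s)) d s by [].
  have -> : put (put (G (c :: x1, x2)) d s) w x1 3 = x2.
    by rewrite put_other 1?eq_sym // put_other 1?eq_sym // put_same.
  rewrite /G /next; move/eqP: w3; move/eqP: wd; move/eqP: d3 => d3 wd w3 /=.
  by put_ext.
have e2 m : forall x, drained next x (nseq m true)
    = (drop m x.1, catrev (take m x.1) x.2).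
  elim: m => [|m IH] [x y] /=; first by rewrite drop0 take0.
  by rewrite IH /next; case: x.
rewrite {}e2 [(_, _).1]/= [(_, _).2]/= in E2; set st2 := put (G _) d [::] in E2.
have e3 : st2 w = drop v u by rewrite /st2 put_other // /G put_other // put_same.
have E3 := ExecPop w (fun _ a => (a == Some true, a)) (b, None) st2.
rewrite e3 in E3; set f := (_ == _, _) in E3; set st3 := put _ _ _ in E3.
have [n4 [Hn4 E4]] : exists n4, n4 <= 3 /\
    exec (Cond loaded (Push w loaded_bit) skip) f st3 n4 f st2.
  rewrite /f /st3; case eD: (drop v u) => [|c s] /=.
    exists 2; split=> //; apply: ExecCond => /=.
    by rewrite put_id ?e3 //; exact: exec_skip.
  exists 3; split=> //; apply: ExecCond => /=.
  have := ExecPush w loaded_bit (Some c == Some true, Some c) (put st2 w s).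
  rewrite put_same put_put /=.
  suff -> : put st2 w (c :: s) = st2 by [].
  by rewrite put_id // e3.
have w3' : 3 != nat_of_bool w by rewrite eq_sym.
have [n5 [Hn5 E5]] := exec_transfer st2 f.1 f.2 w3'.
have e5 : st2 3 = rev (take v u).
  by rewrite /st2 put_other 1?eq_sym // /G put_same catrevE cats0.
have e6 : put (put st2 w u) 3 [::] = st.
  rewrite /st2 /G -eu; move/eqP: w3; move/eqP: wd; move/eqP: d3 => d3 wd w3.
  by put_ext; rewrite ?(frame_tmp F) ?(frame_free F).
rewrite e5 e3 catrevE revK cat_take_drop e6 in E5.
exists (n1 + (n2 + ((1 + n4) + n5))), None; split.
  have : size (st2 3) <= B.
    by rewrite e5 size_rev size_take_min; apply: leq_trans (geq_minr _ _) Hu.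
  by rewrite size_nseq in Hn2; nia.
have -> : nth false u v = f.1.
  by rewrite /f /= -{1}[v]addn0 -nth_drop; case: (drop v u) => [|[]].
have e7 : G (u, [::]) = st by rewrite /G (put_id (i := w)) // put_id ?(frame_tmp F).
rewrite e7 in E2; apply: ExecThen E1 _; apply: ExecThen E2 _.
by apply: ExecThen (ExecThen E3 E4) _; case: (f) E5.
Qed.

Lemma iotaS_rcons m n : iota m n.+1 = rcons (iota m n) (m + n).
Proof. by rewrite -addn1 iotaD cats1. Qed.

(** A quantifier runs its body with values bounded by [B + V B]. The nesting depth is fixed by the
    formula, so the composed bounds stay polynomial. *)
Lemma exec_formula phi : exists2 K, poly_bounded K &
  forall ws env B st b r, bounded ws env B -> frame ws env (4 + size env) st ->
  exists n r', n <= K B /\ exec (formula_code phi (size env)) (b, r) st n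
    (holds ws env phi, r') st.
Proof.
elim: phi => [c|e1 e2|w e|phi [K PK HK]|phi [K1 P1 H1] psi [K2 P2 H2]|e phi [K PK HK]].
- exists (fun=> 1); first exact: poly_bounded_const.
  move=> ws env B st b r _ F; exists 1, r; split=> //.
  exact: (exec_set (fun f => (c, f.2)) _ (frame_tmp F)).
- exact: exec_lt.
- exact: exec_bit.
- exists (fun B => K B + 1); first exact: poly_bounded_add (poly_bounded_const 1).
  move=> ws env B st b r HB F; have [n [r' [Hn E]]] := HK ws env B st b r HB F.
  exists (n + 1), r'; split; first by rewrite leq_add2r.
  by apply: ExecThen E (exec_set (fun f => (~~ f.1, f.2)) _ (frame_tmp F)).
- exists (fun B => K1 B + (K2 B + 2)).
    by do 2?apply: poly_bounded_add => //; exact: poly_bounded_const.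
  move=> ws env B st b r HB F.
  have [n1 [r1 [Hn1 E1]]] := H1 ws env B st b r HB F.
  rewrite /=; case eh: (holds ws env phi) E1 => E1.
    have [n2 [r2 [Hn2 E2]]] := H2 ws env B st true r1 HB F.
    exists (n1 + n2.+1), r2; split; first lia.
    by apply: ExecThen E1 _; apply: ExecCond.
  exists (n1 + 2), r1; split; first lia.
  by apply: ExecThen E1 _; apply: ExecCond; exact: exec_skip.
have [Ke Pe He] := exec_expr_free e; have [V PV HV] := value_bounded e.
exists (fun B => Ke B + (1 + (V B).+1 * (K (B + V B) + 5))).
  do 2?apply: poly_bounded_add => //; first exact: poly_bounded_const.
  apply: poly_bounded_mul; first exact: poly_bounded_succ.
  apply: poly_bounded_add (poly_bounded_const _).
  by apply: poly_bounded_comp => //; exact: poly_bounded_add poly_bounded_id _.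
move=> ws env B st b r HB F /=; set d := 4 + size env in F *.
have := HV _ _ _ HB; move: (He ws env); set v := value _ _ e => {}He Hv.
have [|n1 [r1 [Hn1 E1]]] := He B d.+1 d st b r HB F; first by rewrite leqnn ltnSn.
have E2 := exec_set (fun f => (false, f.2)) (b, r1)
  (frame_tmp (frame_put (nseq v true) F (s' := d.+1) (d := d) ltac:(by rewrite leqnn ltnSn)
    (leqnSn _))).
pose next x (_ : bool) (s : seq bool) := x || holds ws (rcons env (size s)) phi.
have [|x a s [Us Hs]||n3 [Hn3 E3]] := @exec_drain _ next (fun=> st) id
  (fun s => unary s /\ size s <= v) d (Cond fst skip (formula_code phi (size env).+1))
  (K (B + V B) + 2) _ _ (nseq v true) false r1 _.
- by move=> a s [/unary_behead Us /= Hs]; split=> //; lia.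
- case: x => /=.
    exists 2, (Some a); split; first lia.
    by apply: ExecCond; exact: exec_skip.
  have sV : size s <= V B by rewrite /= in Hs; lia.
  have HB' := bounded_rcons HB sV.
  have F' := frame_rcons (size s) F; rewrite -(unary_behead Us) in F'.
  have [n [r' [Hn E]]] := HK _ _ _ _ false (Some a) HB' F'.
  exists n.+1, r'; split; first lia.
  by apply: ExecCond; move: E; rewrite size_rcons.
- by split; [exact: unary_nseq | rewrite size_nseq].
exists (n1 + (1 + n3)), None; split.
  by rewrite size_nseq in Hn3; nia.
have -> : has (fun n => holds ws (rcons env n) phi) (iota 0 v) = drained next false (nseq v true).
  suff -> : forall x m, drained next x (nseq m true)
    = x || has (fun n => holds ws (rcons env n) phi) (iota 0 m) by [].
  move=> x m; elim: m x => [|m IH] x; first by rewrite orbF.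
  by rewrite [LHS]IH iotaS_rcons has_rcons /next size_nseq orbA.
apply: ExecThen E1 (ExecThen E2 _); move: E3.
by rewrite (put_id (i := d) (s := [::])) ?(frame_free F).
Qed.

Lemma exec_halve d st v b r : st d.+1 = [::] -> st d.+2 = [::] ->
  exists n, n <= v.+1 * 7 + 1 /\
    exec (halve d) (b, r) (put st d (nseq v true)) n
      (odd v, None) (put (put st d.+1 (nseq v./2 true)) d [::]).
Proof.
move=> s1 s2; have d1 : d.+1 <> d by lia.
have d2 : d.+2 <> d by lia.
have d21 : d.+2 <> d.+1 by lia.
pose next (x : bool * seq bool) (_ : bool) (_ : seq bool) :=
  (~~ x.1, if x.1 then true :: x.2 else x.2).
have [|[x t] a s _|n [Hn E]] := @exec_drain _ next (fun x => put st d.+1 x.2) fst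
  (fun=> True) d (Then (Cond fst (Push d.+1 (fun=> true)) skip)
    (Pop d.+2 (fun f _ => (~~ f.1, f.2)))) 4 _ _ (nseq v true) (false, [::]) r I.
- by [].
- have G2 y : put (put st d.+1 y) d s d.+2 = [::].
    by rewrite /put; repeat case: eqP => // ?; lia.
  have S y := exec_set (fun f => (~~ f.1, f.2)) (x, Some a) (G2 y).
  case: x S => S.
    exists (3 + 1), (Some a); split=> //; apply: ExecThen (S _); apply: ExecCond.
    have := ExecPush d.+1 (fun=> true) (true, Some a) (put (put st d.+1 t) d s).
    suff -> : put (put (put st d.+1 t) d s) d.+1 (true :: put (put st d.+1 t) d s d.+1)
      = put (put st d.+1 (true :: t)) d s by [].
    have -> : put (put st d.+1 t) d s d.+1 = t.
      by rewrite /put eqxx; case: eqP.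
    by put_ext.
  exists (2 + 1), (Some a); split=> //; apply: ExecThen (S _); apply: ExecCond.
  exact: exec_skip.
have eq_drained m : forall x t, drained next (x, t) (nseq m true)
    = (x (+) odd m, nseq (m + x)./2 true ++ t).
  elim: m => [|m IH] [] t //=; rewrite IH /=.
  - rewrite addn0 addn1 /= negbK; congr (_, _).
    by elim: (m./2) => //= ? ->.
  - by rewrite addn0 addn1; case: (odd m).
rewrite eq_drained addn0 cats0 /= (put_id (i := d.+1) (s := [::])) // in E.
exists (1 + n); split; first by rewrite size_nseq in Hn; lia.
apply: ExecThen E.
apply: (exec_set (fun f => (false, f.2)) (b, r)).
by rewrite put_other //; apply/eqP.
Qed.

Lemma exec_binary d st v b r : 3 < d ->
  st 3 = [::] -> st d = [::] -> st d.+1 = [::] -> st d.+2 = [::] ->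
  exists n f, n <= v.+1 * v.+1 * 20 + v.+1 * 5 + 2 /\
    exec (binary_code d) (b, r) (put st d (nseq v true)) n f (put st 2 (bits v ++ st 2)).
Proof.
move=> d3 s3 s0 s1 s2; have d1 : d.+1 <> d by lia.
have d2 : d.+2 <> d by lia.
have d21 : d.+2 <> d.+1 by lia.
(* One unit of the counter has already been loaded, hence [behead]. *)
pose S v u := put (put st d (behead (nseq v true))) 3 u.
have step : exists n b', n <= v.+1 * v.+1 * 20 /\ exec (Loop loaded
    (Then (Push d loaded_bit) (Then (halve d) (Then (Push 3 fst)
       (Then (transfer d.+1 d) (load d))))))
    (b, ohead (nseq v true)) (S v [::]) n (b', None) (S 0 (catrev (bits v) [::])).
  move: [::] b => u b; elim/ltn_ind: v u b => -[_ u b|v IH u b].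
    by exists 1, b; split=> //; apply: ExecLoopF.
  have [||n1 [Hn1 E1]] := @exec_halve d (put st 3 u) v.+1 b (Some true).
  - by rewrite put_other //; lia.
  - by rewrite put_other //; lia.
  set o := odd v.+1 in E1; set h := v.+1./2 in E1.
  have hv : h < v.+1 by rewrite /h; lia.
  pose st1 := put (put (put st 3 u) d.+1 (nseq h true)) d [::].
  rewrite -/st1 in E1.
  have d11 : d.+1 != d by apply/eqP.
  have [n2 [Hn2 E2]] := @exec_transfer d.+1 d (put st1 3 (o :: u)) o None d11.
  have [n3 [b' [Hn3 E3]]] := IH h hv (o :: u) o.
  have e1 : put st1 3 (o :: u) d.+1 = nseq h true.
    by rewrite /st1 /put eqxx; repeat case: eqP => //; lia.
  have e2 : put st1 3 (o :: u) d = [::].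
    by rewrite /st1 /put eqxx; repeat case: eqP => //; lia.
  have e3 : catrev (nseq h true) [::] = nseq h true.
    have cn m : forall t, catrev (nseq m true) (nseq t true) = nseq (m + t) true.
      by elim: m => //= m IHm t; rewrite -[true :: _]/(nseq t.+1 true) IHm addnS.
    by have := cn h 0; rewrite addn0.
  have e4 : put (put (put st1 3 (o :: u)) d (nseq h true)) d.+1 [::]
      = put (put st d (nseq h true)) 3 (o :: u).
    by rewrite /st1; put_ext.
  rewrite e1 e2 e3 e4 size_nseq in E2 Hn2.
  exists (2 + (n1 + (2 + (n2 + 1))) + n3).+1, b'; split.
    have : h.*2 <= v.+1 by rewrite /h; lia.
    nia.
  rewrite bits_half // -/o -/h [catrev (_ :: _) _]/=.
  apply: ExecLoopT E3 => //.
  apply: (ExecThen (f1 := (b, Some true)) (st1 := put (put st 3 u) d (nseq v.+1 true))).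
    have := ExecPush d loaded_bit (b, Some true) (S v.+1 u).
    suff -> : put (S v.+1 u) d (loaded_bit (b, Some true) :: S v.+1 u d)
      = put (put st 3 u) d (nseq v.+1 true) by [].
    have -> : S v.+1 u d = nseq v true.
      by rewrite /S put_other ?put_same //; lia.
    by rewrite /S; put_ext.
  apply: ExecThen E1 _; apply: (ExecThen (f1 := (o, None)) (st1 := put st1 3 (o :: u))).
    have := ExecPush 3 fst (o, None) st1.
    suff -> : st1 3 = u by [].
    by rewrite /st1 /put; repeat case: eqP => //; lia.
  apply: ExecThen E2 _.
  have := ExecPop d (fun f a => (f.1, a)) (o, None) (put (put st d (nseq h true)) 3 (o :: u)).
  have -> : put (put st d (nseq h true)) 3 (o :: u) d = nseq h true.
    by rewrite put_other ?put_same //; lia.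
  suff -> : put (put (put st d (nseq h true)) 3 (o :: u)) d (behead (nseq h true))
    = S h (o :: u) by [].
  by rewrite /S; put_ext.
have [n1 [b1 [Hn1 E1]]] := step.
have [n2 [Hn2 E2]] := exec_transfer (S 0 (catrev (bits v) [::])) b1 None (isT : 3 != 2).
have e3 : S 0 (catrev (bits v) [::]) 3 = rev (bits v) by rewrite /S put_same catrevE cats0.
have e2 : S 0 (catrev (bits v) [::]) 2 = st 2.
  by rewrite /S put_other // put_other //; lia.
have sb : size (bits v) <= v.
  case: (v) => // m; rewrite size_mkseq.
  exact: leq_trans (ltn_expl _ (isT : 1 < 2)) (trunc_logP (isT : 1 < 2) (ltn0Sn m)).
rewrite e3 e2 size_rev (catrevE (rev _)) revK in E2 Hn2.
exists (1 + (n1 + n2)), (b1, None); split; first by nia.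
apply: (ExecThen (f1 := (b, ohead (nseq v true))) (st1 := S v [::])).
  have := ExecPop d (fun f a => (f.1, a)) (b, r) (put st d (nseq v true)).
  rewrite put_same.
  suff -> : put (put st d (nseq v true)) d (behead (nseq v true)) = S v [::] by [].
  by rewrite /S put_put (put_id (i := 3)) // put_other //; lia.
apply: ExecThen E1 _; move: E2.
suff -> : put (put (S 0 (catrev (bits v) [::])) 2 (bits v ++ st 2)) 3 [::]
  = put st 2 (bits v ++ st 2) by [].
by rewrite /S; put_ext.
Qed.

Lemma frame_out ws env s st x : 2 < s -> frame ws env s st -> frame ws env s (put st 2 x).
Proof.
move=> s2 [Fi Ft Fe Ff]; split=> //; first by move=> w; rewrite put_other ?Fi //; case: w.
by move=> i si; rewrite put_other ?Ff //; lia.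
Qed.

Lemma exec_cmd c : exists2 K, poly_bounded K &
  forall ws env B st r, bounded ws env B -> frame ws env (4 + size env) st ->
  exists n r', n <= K B /\ exec (cmd_code c (size env)) (true, r) st n (true, r')
    (put st 2 (emits ws env c ++ st 2)).
Proof.
elim: c => [|phi|c1 [K1 P1 H1] c2 [K2 P2 H2]|e c [K PK HK]|e].
- exists (fun=> 1); first exact: poly_bounded_const.
  move=> ws env B st r _ _; exists 1, r; split=> //.
  by rewrite put_id //; exact: exec_skip.
- have [K PK HK] := exec_formula phi.
  exists (fun B => K B + 3); first exact: poly_bounded_add (poly_bounded_const 3).
  move=> ws env B st r HB F; have [n [r' [Hn E]]] := HK _ _ _ _ true r HB F.
  exists (n + 2 + 1), r'; split; first lia.
  apply: ExecThen (ExecThen E (ExecPush 2 fst _ _)) _.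
  by apply: (exec_set (fun f => (true, f.2))); exact: frame_tmp F.
- exists (fun B => K1 B + K2 B); first exact: poly_bounded_add.
  move=> ws env B st r HB F.
  have [n2 [r2 [Hn2 E2]]] := H2 _ _ _ _ r HB F.
  have F2 : frame ws env (4 + size env) (put st 2 (emits ws env c2 ++ st 2)).
    exact: frame_out.
  have [n1 [r1 [Hn1 E1]]] := H1 _ _ _ _ r2 HB F2.
  exists (n2 + n1), r1; split; first lia.
  by apply: ExecThen E2 _; move: E1; rewrite put_put put_same /= catA.
- have [Ke Pe He] := exec_expr_free e; have [V PV HV] := value_bounded e.
  exists (fun B => Ke B + (V B).+1 * (K (B + V B) + 3)).
    apply: poly_bounded_add => //; apply: poly_bounded_mul; first exact: poly_bounded_succ.
    apply: poly_bounded_add (poly_bounded_const _).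
    by apply: poly_bounded_comp => //; exact: poly_bounded_add poly_bounded_id _.
  move=> ws env B st r HB F /=; set d := 4 + size env in F *.
  have := HV _ _ _ HB; move: (He ws env); set v := value _ _ e => {}He Hv.
  have [|n1 [r1 [Hn1 E1]]] := He B d.+1 d st true r HB F; first by rewrite leqnn ltnSn.
  pose next (x : seq bool) (_ : bool) (s : seq bool) := emits ws (rcons env (size s)) c ++ x.
  have d2 : d <> 2 by rewrite /d; lia.
  have [|x a s [Us Hs]||n3 [Hn3 E3]] := @exec_drain _ next (put st 2) (fun=> true)
    (fun s => unary s /\ size s <= v) d (cmd_code c (size env).+1)
    (K (B + V B)) _ _ (nseq v true) (st 2) r1 _.
  + by move=> a s [/unary_behead Us /= Hs]; split=> //; lia.
  + have sV : size s <= V B by rewrite /= in Hs; lia.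
    have HB' := bounded_rcons HB sV.
    have F0 : frame ws env d (put st 2 x) by exact: frame_out.
    have F' := frame_rcons (size s) F0; rewrite -(unary_behead Us) in F'.
    have [n [r' [Hn E]]] := HK _ _ _ _ (Some a) HB' F'.
    exists n, r'; split=> //; move: E; rewrite size_rcons /next.
    rewrite [put (put st 2 x) _ s 2]put_other // put_same.
    suff -> : forall y, put (put (put st 2 x) (4 + size env) s) 2 y = put (put st 2 y) d s by [].
    by move=> y; put_ext.
  + by split; [exact: unary_nseq | rewrite size_nseq].
  exists (n1 + n3), None; split.
    by rewrite size_nseq in Hn3; nia.
  apply: ExecThen E1 _; move: E3.
  rewrite (put_id (i := 2) (s := st 2)) //.
  have -> : forall m x, drained next x (nseq m true)
    = flatten [seq emits ws (rcons env n) c | n <- iota 0 m] ++ x.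
    elim=> [|m IH] x //; rewrite [LHS]IH iotaS_rcons map_rcons flatten_rcons.
    by rewrite /next size_nseq catA.
  suff -> : forall y, put (put st 2 y) d [::] = put st 2 y by [].
  move=> y; rewrite put_id // put_other //; exact: frame_free F _ _.
- have [K PK HK] := exec_expr_free e; have [V PV HV] := value_bounded e.
  exists (fun B => K B + ((V B).+1 * (V B).+1 * 20 + (V B).+1 * 5 + 2) + 1).
    have PS := poly_bounded_succ PV; have PC := poly_bounded_const.
    by do ![apply: poly_bounded_add | apply: poly_bounded_mul].
  move=> ws env B st r HB F /=; set d := 4 + size env in F *.
  have := HV _ _ _ HB; move: (HK ws env); set v := value _ _ e => {}HK Hv.
  have [|n1 [r1 [Hn1 E1]]] := HK B d.+1 d st true r HB F; first by rewrite leqnn ltnSn.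
  have [|||||n2 [f [Hn2 E2]]] := @exec_binary d st v true r1; first by rewrite /d; lia.
  + exact: frame_tmp F.
  + exact: frame_free F _ _.
  + by apply: (frame_free F).
  + by apply: (frame_free F); lia.
  exists (n1 + n2 + 1), f.2; split.
    by have : v.+1 * v.+1 <= (V B).+1 * (V B).+1 by [exact: leq_mul]; lia.
  apply: ExecThen (ExecThen E1 E2) _.
  by apply: (exec_set (fun f => (true, f.2))); exact: frame_tmp F.
Qed.

(** * Polynomial time and NP from programs *)

(** The running time also bounds the stack heights, hence the cost of clearing the input and of
    moving the output to tape 0. *)
Lemma exec_size c f st n f' st' :
  exec c f st n f' st' -> forall i, size (st' i) <= size (st i) + n.
Proof.
elim=> {c f st n f' st'} [j g f st|j g f st|c1 c2 f st n1 f1 st1 n2 f2 st2 _ IH1 _ IH2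
  |b c1 c2 f st n f' st' _ IH|b c f st _|b c f st n1 f1 st1 n2 f2 st2 _ _ IH1 _ IH2] i.
- by rewrite /put; case: eqP => [->|_]; rewrite ?size_behead; lia.
- by rewrite /put; case: eqP => [->|_] /=; lia.
- by have := IH1 i; have := IH2 i; lia.
- by have := IH i; lia.
- lia.
- by have := IH1 i; have := IH2 i; lia.
Qed.

Lemma poly_bounded_poly f : poly_bounded f ->
  exists p : {poly nat}, forall n, f n <= (p.[n])%R.
Proof.
move=> [D HD]; exists (('X + 2%:P) ^+ D)%R => n.
by rewrite horner_exp hornerD hornerX hornerC natrXE natrDE addn2.
Qed.

Lemma frame_init ws : size ws <= 2 -> frame ws [::] 4 (fun i => nth [::] ws i).
Proof.
move=> s; split=> // [|i si]; rewrite nth_default //; first exact: leq_trans s _.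
by apply: leq_trans s _; apply: leq_trans si.
Qed.

Lemma emits_poly_time c : poly_time_computable (fun x => emits [:: x] [::] c).
Proof.
have [K PK HK] := exec_cmd c.
pose prog := Then (cmd_code c 0) (Then (drain 0 skip) (Then (transfer 2 3) (transfer 3 0))).
(* The summands pay for the program, for clearing stack 0 and for two transfers of the output, the
   second of which undoes the reversal by the first. *)
have [p Hp] : exists p : {poly nat}, forall n,
    K n + (n + K n).+1 * 4 + (K n).+1 * 10 <= (p.[n])%R.
  apply: poly_bounded_poly; do ![apply: poly_bounded_add | apply: poly_bounded_mul
    | apply: poly_bounded_succ | exact: poly_bounded_const | exact: poly_bounded_id] => //.
exists (code_machine (max_stack prog) prog), p => x.
pose st : stacks := fun i => nth [::] [:: x] i.
have F : frame [:: x] [::] 4 st by exact: frame_init.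
have HB : bounded [:: x] [::] (size x).
  by split=> [[]|i] //; rewrite nth_nil.
have [n1 [r1 [Hn1 E1]]] := HK _ _ _ _ None HB F.
set out := emits _ _ _ in E1 *; set st1 := put _ _ _ in E1.
have st12 : st1 2 = out by rewrite /st1 put_same cats0.
have [n2 [Hn2 E2]] := exec_clear 0 st1 true r1.
set st2 := put _ _ _ in E2.
have [n3 [Hn3 E3]] := exec_transfer st2 true None (isT : 2 != 3).
set st3 := put _ _ _ in E3.
have [n4 [Hn4 E4]] := exec_transfer st3 true None (isT : 3 != 0).
set st4 := put _ _ _ in E4.
have s0 : size (st1 0) <= size x + n1 := exec_size E1 0.
have s2 : size (st1 2) <= 0 + n1 := exec_size E1 2.
have st22 : st2 2 = out by rewrite /st2 put_other.
have st33 : st3 3 = rev out.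
  by rewrite /st3 put_other // put_same st22 /st2 put_other // /st1 put_other // catrevE cats0.
have st40 : st4 0 = out.
  rewrite /st4 put_other // put_same st33 catrevE revK.
  by rewrite /st3 put_other // put_other // /st2 put_same cats0.
rewrite st22 in Hn3; rewrite st33 size_rev in Hn4.
rewrite st12 in s2.
have E : exec prog (true, None) st (n1 + (n2 + (n3 + n4))) (true, None) st4.
  exact: ExecThen E1 (ExecThen E2 (ExecThen E3 E4)).
have [|tp Htp run_eq] := @code_machine_run prog [:: x] _ _ _ (p.[size x])%R _ (leqnn _) _ E.
  by apply: leq_trans (Hp _); lia.
rewrite /halts_in run_eq; split=> //.
rewrite /output /=; have [_ [m]] := Htp ord0; rewrite /= st40 => ->.
by elim: (out) => [|b s IH] /=; [case: m | rewrite IH].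
Qed.

Lemma formula_in_NP (L : language) phi (q : {poly nat}) :
  (forall x, L x <-> exists2 w, size w <= (q.[size x])%R & holds [:: x; w] [::] phi) ->
  in_NP L.
Proof.
move=> HL; have [K PK HK] := exec_formula phi.
have [p Hp] : exists p : {poly nat}, forall n, K (n + (q.[n])%R) <= (p.[n])%R.
  apply: poly_bounded_poly; apply: (poly_bounded_comp PK).
  exact: poly_bounded_add poly_bounded_id (horner_poly_bounded q).
have run_phi x w : size w <= (q.[size x])%R -> exists tp r,
    run (code_machine (max_stack (formula_code phi 0)) (formula_code phi 0))
      (p.[size x])%R [:: x; w] = ((None, (holds [:: x; w] [::] phi, r)), tp).
  move=> sw; have HB : bounded [:: x; w] [::] (size x + (q.[size x])%R).
    split=> [[]|i]; rewrite ?nth_nil //; last exact: leq_addr.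
    exact: leq_trans sw (leq_addl _ _).
  have [n [r [Hn E]]] := HK _ _ _ _ true None HB (frame_init (ws := [:: x; w]) isT).
  have [|tp _ ->] := @code_machine_run _ [:: x; w] _ _ _ (p.[size x])%R _ (leqnn _) _ E.
    exact: leq_trans (Hp _).
  by exists tp, r.
exists (code_machine (max_stack (formula_code phi 0)) (formula_code phi 0)), p, q => x.
split=> [w /run_phi[tp [r e]]|]; first by rewrite /halts_in e.
rewrite HL; split=> -[w sw]; have [tp [r e]] := run_phi _ _ sw => H; exists w => //.
  by rewrite /accepts_in e.
by move: H; rewrite /accepts_in e => -[].
Qed.

(** * Interval models *)

Lemma interval_convex (R : realType) (i : interval R) (x y z : R) :
  x \in i -> z \in i -> (x <= y <= z)%R -> y \in i.
Proof.
case: i => l u; rewrite !inE => /andP[lx _] /andP[_ zu] /andP[xy yz].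
apply/andP; split; first by apply: le_trans lx _; rewrite bnd_simp.
by apply: le_trans zu; rewrite bnd_simp.
Qed.

Lemma interval_graph_nat (R : realType) (G : sgraph) (lo hi : G -> nat) :
  (forall v, lo v <= hi v) ->
  (forall u v, u != v -> edge u v = (lo u <= hi v) && (lo v <= hi u)) ->
  interval_graph R G.
Proof.
move=> lohi He.
exists (fun v => `[(lo v)%:R%R, (hi v)%:R%R])%O; split.
  by move=> v; exists (lo v)%:R%R; rewrite in_itv /= lexx ler_nat lohi.
move=> u v uv; rewrite He //; split.
  move=> /andP[uv1 vu1]; exists (maxn (lo u) (lo v))%:R%R.
  by rewrite !in_itv /= !ler_nat !geq_max !leq_max !leqnn ?orbT /= !lohi uv1 vu1.
move=> [x []]; rewrite !in_itv /= => /andP[ux xu] /andP[vx xv].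
rewrite -!(ler_nat R); apply/andP; split.
  exact: le_trans ux xv.
exact: le_trans vx xu.
Qed.

Section IntervalObstruction.
Variables (R : realType) (G : sgraph) (C : {set G}).
Hypothesis C_clique : is_clique C.

Definition private (a b : G) := exists2 c, c \in C & edge c a /\ ~~ edge c b.

(* Two intersecting (or equal) intervals that meet the intervals of a and c cover
   everything between them, so the middle one of the three has no private pair. *)
Lemma interval_no_antichain (r : 'I_3 -> G) :
  interval_graph R G -> (forall i, r i \notin C) ->
  (forall i j, i != j -> [/\ r i != r j, ~~ edge (r i) (r j) & private (r i) (r j)]) ->
  False.
Proof.
move=> [I [Ine Iedge]] rC Hr.
have [y Hy] := fin_all_exists (fun i => Ine (r i)).
have disj i j x : i != j -> x \in I (r i) -> x \in I (r j) -> False.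
  move=> /Hr[rij /negP nij _] xi xj; apply: nij.
  by apply/(Iedge _ _ rij); exists x.
have between a b c : a != b -> c != b -> (y a <= y b <= y c)%R -> False.
  move=> ab cb /andP[yab ybc].
  have [_ _ [al alC [ala alb]]] := Hr _ _ ab.
  have [_ _ [ga gaC [gac gab]]] := Hr _ _ cb.
  have nr v i : v \in C -> v != r i.
    by move=> vC; apply/eqP => e; have := rC i; rewrite -e vC.
  have [x1 [x1al x1a]] := (Iedge _ _ (nr _ a alC)).1 ala.
  have [x3 [x3ga x3c]] := (Iedge _ _ (nr _ c gaC)).1 gac.
  (* Otherwise the interval of [a] would contain [y b] by convexity and meet that of [b]. *)
  have x1b : (x1 <= y b)%R.
    rewrite leNgt; apply/negP => /ltW lt.
    apply: (disj a b (y b) ab) => //.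
    by apply: interval_convex (Hy a) x1a _; rewrite yab lt.
  have bx3 : (y b <= x3)%R.
    rewrite leNgt; apply/negP => /ltW lt.
    apply: (disj c b (y b) cb) => //.
    by apply: interval_convex x3c (Hy c) _; rewrite ybc lt.
  (* On whichever side of [y b] the common point [z] lies, one of the two clique intervals covers
     [y b] and so is not private. *)
  have [z [zal zga]] : exists z, z \in I al /\ z \in I ga.
    have [e|ne] := eqVneq al ga; first by exists x1; rewrite -e.
    by apply/(Iedge _ _ ne); exact: C_clique.
  have [byz|zyb] := leP (y b) z.
    move/negP: alb; apply; apply/(Iedge _ _ (nr _ b alC)); exists (y b); split=> //.
    by apply: interval_convex x1al zal _; rewrite x1b.
  move/negP: gab; apply; apply/(Iedge _ _ (nr _ b gaC)); exists (y b); split=> //.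
  by apply: interval_convex zga x3ga _; rewrite bx3 ltW.
pose i0 : 'I_3 := @Ordinal 3 0 isT; pose i1 : 'I_3 := @Ordinal 3 1 isT.
pose i2 : 'I_3 := @Ordinal 3 2 isT.
have [y01|/ltW y01] := leP (y i0) (y i1);
have [y12|/ltW y12] := leP (y i1) (y i2);
have [y02|/ltW y02] := leP (y i0) (y i2).
- by apply: (@between i0 i1 i2) => //; rewrite y01.
- by apply: (@between i0 i1 i2) => //; rewrite y01.
- by apply: (@between i0 i2 i1) => //; rewrite y02.
- by apply: (@between i2 i0 i1) => //; rewrite y02.
- by apply: (@between i1 i0 i2) => //; rewrite y01.
- by apply: (@between i1 i2 i0) => //; rewrite y12.
- by apply: (@between i2 i1 i0) => //; rewrite y12.
- by apply: (@between i2 i1 i0) => //; rewrite y12.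
Qed.

End IntervalObstruction.

(** A finite form of interval models, which a certificate can list bit by bit. *)
Definition point_model (V : Type) (E : V -> V -> Prop) (A : V -> nat -> Prop) m :=
  [/\ forall v, exists2 p, p < m & A v p,
      forall v p q r, p < q < r -> r < m -> A v p -> A v r -> A v q &
      forall u v, u <> v -> E u v <-> exists2 p, p < m & A u p /\ A v p].

(** The least and the greatest point of each set become the end points of its interval; two
    intervals that overlap share the larger of their left ends. *)
Lemma point_model_interval (R : realType) (G : sgraph) A m :
  point_model (fun u v : G => edge u v) A m -> interval_graph R G.
Proof.
move=> [Ane Acvx Aedge].
have ends v : exists e : nat * nat, [/\ A v e.1, A v e.2, e.2 < m &
    forall p, p < m -> A v p -> e.1 <= p <= e.2].
  suff H n : n <= m -> (exists2 p, p < n & A v p) -> exists e : nat * nat,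
      [/\ A v e.1, A v e.2, e.2 < n & forall p, p < n -> A v p -> e.1 <= p <= e.2].
    exact: H.
  elim: n => [_ [p] //|n IH nm [p pn Ap]].
  have [[p' p'n Ap']|no] := boolp.EM (exists2 p, p < n & A v p).
    have [|e [A1 A2 en He]] := IH (ltnW nm); first by exists p'.
    have [An|nAn] := boolp.EM (A v n).
      exists (e.1, n); split=> //= q; rewrite ltnS leq_eqVlt => /orP[/eqP-> _|qn Aq].
        have /andP[e12 _] : e.1 <= e.2 <= e.2 by apply: He.
        by rewrite eqxx andbT; apply: leq_trans e12 (ltnW en).
      by have /andP[-> _] := He q qn Aq; rewrite qn orbT.
    exists e; split=> //; first exact: ltnW.
    by move=> q; rewrite ltnS leq_eqVlt => /orP[/eqP-> //|]; apply: He.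
  have only q : q < n.+1 -> A v q -> q = n.
    rewrite ltnS leq_eqVlt => /orP[/eqP //|qn Aq].
    by case: no; exists q.
  have pe := only _ pn Ap; subst p.
  by exists (n, n); split=> //= q qn Aq; rewrite (only q qn Aq) leqnn.
have [e He] := fin_all_exists ends.
apply: (@interval_graph_nat R G (fun v => (e v).1) (fun v => (e v).2)).
  by move=> v; have [_ A2 em Hv] := He v; have /andP[] := Hv _ em A2.
move=> u v /eqP uv; have [Au1 Au2 um Hu] := He u; have [Av1 Av2 vm Hv] := He v.
apply/idP/idP.
  move=> /(Aedge _ _ uv)[p pm [Aup Avp]].
  have /andP[u1 u2] := Hu _ pm Aup; have /andP[v1 v2] := Hv _ pm Avp.
  by rewrite (leq_trans u1 v2) (leq_trans v1 u2).
have inside w p q r : r < m -> A w p -> A w r -> p <= q <= r -> A w q.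
  move=> rm Ap Ar /andP[]; rewrite leq_eqVlt => /orP[/eqP <- //|pq].
  rewrite leq_eqVlt => /orP[/eqP -> //|qr].
  by apply: Acvx Ap Ar; rewrite ?pq.
move=> /andP[uv1 vu1]; apply/(Aedge _ _ uv).
have u1m := Hu _ um Au2; have v1m := Hv _ vm Av2.
have /andP[u12 _] := u1m; have /andP[v12 _] := v1m.
exists (maxn (e u).1 (e v).1).
  by rewrite gtn_max (leq_ltn_trans u12 um) (leq_ltn_trans v12 vm).
split.
  by apply: inside um Au1 Au2 _; rewrite leq_maxl geq_max u12 vu1.
by apply: inside vm Av1 Av2 _; rewrite leq_maxr geq_max v12 uv1.
Qed.

(** One sample point per ordered pair of vertices, common to both intervals if the vertices are
    adjacent, captures every adjacency, and the diagonal pairs keep the sets non-empty. Sorting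
    replaces the real points by their indices. *)
Lemma interval_point_model (R : realType) (G : sgraph) m :
  #|G| * #|G| <= m -> interval_graph R G ->
  exists A : G -> nat -> bool, point_model (fun u v : G => edge u v) A m.
Proof.
move=> Gm [I [Ine Iedge]].
have [y Hy] := fin_all_exists Ine.
have witness (uv : G * G) : exists x, x \in I uv.1 /\
    (edge uv.1 uv.2 -> x \in I uv.2).
  case: uv => u v /=; have [e|ne] := boolP (edge u v); last by exists (y u).
  have uv : u != v by apply/eqP => uv; rewrite uv edge_irrefl in e.
  by have [x [xu xv]] := (Iedge u v uv).1 e; exists x.
have [x Hx] := fin_all_exists witness.
pose pts := sort <=%R [seq x p | p <- enum [set: G * G]].
have size_pts : size pts <= m by rewrite size_sort size_map -cardE cardsT card_prod.
have sorted_pts p q : p <= q -> q < size pts -> (nth 0 pts p <= nth 0 pts q)%R.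
  move=> pq qs; apply: (sorted_leq_nth le_trans lexx 0%R) => //.
  - exact: sort_le_sorted.
  - by rewrite inE (leq_ltn_trans pq).
have in_pts p : exists2 i, i < size pts & nth 0%R pts i = x p.
  have : x p \in pts by rewrite mem_sort map_f // mem_enum inE.
  by move=> xp; exists (index (x p) pts); rewrite ?index_mem ?nth_index.
exists (fun v p => (p < size pts) && (nth 0%R pts p \in I v)); split.
- move=> v; have [i si e] := in_pts (v, v); exists i; first exact: leq_trans size_pts.
  by rewrite si e; case: (Hx (v, v)).
- move=> v p q r /andP[pq qr] _ /andP[_ Ap] /andP[rs Ar].
  rewrite (ltn_trans qr rs); apply: interval_convex Ap Ar _.
  by rewrite !sorted_pts ?(ltnW pq) ?(ltnW qr) ?(ltn_trans qr rs).
- move=> u v /eqP uv; split.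
    move=> e; have [i si ei] := in_pts (u, v); exists i; first exact: leq_trans size_pts.
    by have [xu xv] := Hx (u, v); rewrite si ei xu xv.
  move=> [p _ [/andP[_ pu] /andP[_ pv]]].
  by apply/(Iedge _ _ uv); exists (nth 0%R pts p).
Qed.

(** * Membership in NP *)

(** Surface syntax: [core] reduces it to the six constructors of [formula], so that only those need
    compiled code. *)
Inductive query :=
| QConst of bool
| QLt of expr & expr
| QLe of expr & expr
| QEq of expr & expr
| QBit of bool & expr
| QNot of query
| QAnd of query & query
| QOr of query & query
| QImp of query & query
| QEx of expr & query
| QAll of expr & query.

Definition some n (P : pred nat) := has P (iota 0 n).
Definition every n (P : pred nat) := all P (iota 0 n).

Lemma someP n (P : pred nat) : reflect (exists2 i, i < n & P i) (some n P).
Proof.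
by apply: (iffP hasP) => -[i]; rewrite ?mem_iota ?add0n => ? ?; exists i; rewrite ?mem_iota.
Qed.

Lemma everyP n (P : pred nat) : reflect (forall i, i < n -> P i) (every n P).
Proof.
by apply: (iffP allP) => H i; have := H i; rewrite mem_iota.
Qed.

Fixpoint ask ws env (q : query) : bool :=
  match q with
  | QConst b => b
  | QLt e1 e2 => value ws env e1 < value ws env e2
  | QLe e1 e2 => value ws env e1 <= value ws env e2
  | QEq e1 e2 => value ws env e1 == value ws env e2
  | QBit w e => nth false (input ws w) (value ws env e)
  | QNot q => ~~ ask ws env q
  | QAnd q1 q2 => ask ws env q1 && ask ws env q2
  | QOr q1 q2 => ask ws env q1 || ask ws env q2
  | QImp q1 q2 => ask ws env q1 ==> ask ws env q2
  | QEx e q => some (value ws env e) (fun n => ask ws (rcons env n) q)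
  | QAll e q => every (value ws env e) (fun n => ask ws (rcons env n) q)
  end.

Fixpoint core (q : query) : formula :=
  match q with
  | QConst b => FConst b
  | QLt e1 e2 => FLt e1 e2
  | QLe e1 e2 => FNot (FLt e2 e1)
  | QEq e1 e2 => FAnd (FNot (FLt e1 e2)) (FNot (FLt e2 e1))
  | QBit w e => FBit w e
  | QNot q => FNot (core q)
  | QAnd q1 q2 => FAnd (core q1) (core q2)
  | QOr q1 q2 => FNot (FAnd (FNot (core q1)) (FNot (core q2)))
  | QImp q1 q2 => FNot (FAnd (core q1) (FNot (core q2)))
  | QEx e q => FEx e (core q)
  | QAll e q => FNot (FEx e (FNot (core q)))
  end.

Lemma holds_core ws env q : holds ws env (core q) = ask ws env q.
Proof.
elim: q env => //= [e1 e2|e1 e2|q IH|q1 IH1 q2 IH2|q1 IH1 q2 IH2|q1 IH1 q2 IH2|e q IH|e q IH] env.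
- by rewrite -leqNgt.
- by rewrite -!leqNgt andbC eqn_leq.
- by rewrite IH.
- by rewrite IH1 IH2.
- by rewrite IH1 IH2 negb_and !negbK.
- by rewrite IH1 IH2 negb_and negbK implybE.
- by apply: eq_has => n; rewrite IH.
- by rewrite -all_predC; apply: eq_all => n /=; rewrite IH negbK.
Qed.

Fixpoint bval (s : word) := if s is b :: s' then b + (bval s').*2 else 0.

Lemma bval_bits n : bval (bits n) = n.
Proof.
elim/ltn_ind: n => -[//|n] IH; rewrite bits_half // -[LHS]/(odd n.+1 + (bval _).*2).
by rewrite IH ?odd_double_half //; lia.
Qed.

Lemma bval_gt0 s : s != [::] -> last false s -> 0 < bval s.
Proof.
elim: s => //= b [_ _ /= ->//|c s IH] _ /= H.
by have := IH isT H; rewrite /=; lia.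
Qed.

(** Expansions are the words whose last letter is one; the default [true] also admits the empty
    word, the expansion of 0. *)
Lemma bits_bval s : last true s -> bits (bval s) = s.
Proof.
elim: s => //= b s IH H.
have ls : last true s by case: s H {IH}.
rewrite bits_half; last by apply: (@bval_gt0 (b :: s)) => //; case: s H {IH ls}.
by rewrite oddD odd_double addbF oddb half_bit_double IH.
Qed.

Lemma nth_allpairs (S T W : Type) (f : S -> T -> W) (x0 : S) (y0 : T) z0 s t i j :
  i < size s -> j < size t ->
  nth z0 [seq f x y | x <- s, y <- t] (i * size t + j) = f (nth x0 s i) (nth y0 t j).
Proof.
move=> + jt; elim: s i => //= x s IH [|i] /= si.
  by rewrite mul0n add0n nth_cat size_map jt (nth_map y0).
rewrite nth_cat size_map mulSn -addnA ltnNge leq_addr /= addKn; exact: IH.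
Qed.

(* The adjacency matrix starts right after the n ones and the zero. *)
Definition adj (x : word) n u v := nth false x (n + 1 + (u * n + v)).

(* [R 0 u 0]: u is deleted; [R 1 u 0]: u is in the clique; [R 2 u j]: j is the rank of u
   among the deleted vertices; [R 3 i j]: j is at most the number with binary expansion
   [drop i x]; [R 4 u p]: the point p is in the interval of u. *)
Record certified (x : word) (n : nat) (R : nat -> nat -> nat -> bool) : Prop := Certified {
  cert_ones : forall i, i < n -> nth false x i;
  cert_zero : ~~ nth false x n;
  cert_size : n + 1 + n * n < size x;
  cert_last : forall i, i < size x -> i + 1 = size x -> nth false x i;
  cert_sym : forall u v, u < n -> v < n -> adj x n u v -> adj x n v u;
  cert_irr : forall u, u < n -> ~~ adj x n u u;
  cert_clique : forall u v, u < n -> v < n -> u <> v -> R 1 u 0 -> R 1 v 0 -> adj x n u v;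
  cert_indep : forall u v, u < n -> v < n -> ~~ R 1 u 0 -> ~~ R 1 v 0 -> ~~ adj x n u v;
  cert_rank : forall u, u < n -> R 0 u 0 ->
    exists2 j, j < n & R 2 u j && R 3 (n + 1 + n * n) (j + 1);
  cert_inj : forall u v j, u < n -> v < n -> j < n -> R 2 u j -> R 2 v j -> u = v;
  (* The binary value from position i on is the i-th letter plus twice the next value. *)
  cert_bits : forall i j, i < size x -> j < n + 1 -> n + 1 + n * n <= i -> R 3 i j -> 0 < j ->
    exists2 j', j' < n + 1 & ((j <= 2 * j') || nth false x i && (j <= 2 * j' + 1))
      && ((j' == 0) || (i + 1 < size x) && R 3 (i + 1) j');
  cert_point : forall u, u < n -> ~~ R 0 u 0 -> exists2 p, p < size x & R 4 u p;
  cert_convex : forall u p q r, u < n -> p < size x -> q < size x -> r < size x ->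
    p < q -> q < r -> R 4 u p -> R 4 u r -> R 4 u q;
  cert_edge : forall u v, u < n -> v < n -> u <> v -> ~~ R 0 u 0 -> ~~ R 0 v 0 ->
    adj x n u v <-> exists2 p, p < size x & R 4 u p && R 4 v p }.

(** The arguments of the five relations are at most the length of the input, so the length plus one
    is a radix for packing them into one word. *)
Definition side := Add (Len false) (Num 1).
Definition rel_at r a b := QBit true (Add (Mul (Add (Mul (Num r) side) a) side) b).
(** [Var 0] is the number of vertices, which [membership_query] binds first. *)
Definition adj_at u v :=
  QBit false (Add (Add (Var 0) (Num 1)) (Add (Mul u (Var 0)) v)).
Definition offset := Add (Add (Var 0) (Num 1)) (Mul (Var 0) (Var 0)).

Definition shape_query :=
  QAnd (QAll (Var 0) (QBit false (Var 1))) (QAnd (QNot (QBit false (Var 0)))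
  (QAnd (QLt offset (Len false))
    (QAll (Len false) (QImp (QEq (Add (Var 1) (Num 1)) (Len false)) (QBit false (Var 1)))))).

Definition split_query :=
  QAll (Var 0) (QAll (Var 0)
    (QAnd (QImp (adj_at (Var 1) (Var 2)) (adj_at (Var 2) (Var 1)))
    (QAnd (QNot (adj_at (Var 1) (Var 1)))
    (QAnd (QImp (QNot (QEq (Var 1) (Var 2)))
            (QImp (rel_at 1 (Var 1) (Num 0)) (QImp (rel_at 1 (Var 2) (Num 0))
              (adj_at (Var 1) (Var 2)))))
          (QImp (QNot (rel_at 1 (Var 1) (Num 0))) (QImp (QNot (rel_at 1 (Var 2) (Num 0)))
             (QNot (adj_at (Var 1) (Var 2))))))))).

Definition budget_query :=
  QAnd (QAll (Var 0) (QImp (rel_at 0 (Var 1) (Num 0))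
    (QEx (Var 0) (QAnd (rel_at 2 (Var 1) (Var 2))
       (rel_at 3 offset (Add (Var 2) (Num 1)))))))
  (QAnd (QAll (Var 0) (QAll (Var 0) (QAll (Var 0)
    (QImp (rel_at 2 (Var 1) (Var 3)) (QImp (rel_at 2 (Var 2) (Var 3))
      (QEq (Var 1) (Var 2)))))))
  (QAll (Len false) (QAll (Add (Var 0) (Num 1))
    (QImp (QLe offset (Var 1)) (QImp (rel_at 3 (Var 1) (Var 2)) (QImp (QLt (Num 0) (Var 2))
      (QEx (Add (Var 0) (Num 1)) (QAnd
        (QOr (QLe (Var 2) (Mul (Num 2) (Var 3)))
          (QAnd (QBit false (Var 1)) (QLe (Var 2) (Add (Mul (Num 2) (Var 3)) (Num 1)))))
        (QOr (QEq (Var 3) (Num 0)) (QAnd (QLt (Add (Var 1) (Num 1)) (Len false))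
          (rel_at 3 (Add (Var 1) (Num 1)) (Var 3)))))))))))).

Definition interval_query :=
  QAnd (QAll (Var 0) (QImp (QNot (rel_at 0 (Var 1) (Num 0)))
    (QEx (Len false) (rel_at 4 (Var 1) (Var 2)))))
  (QAnd (QAll (Var 0) (QAll (Len false) (QAll (Len false) (QAll (Len false)
    (QImp (QLt (Var 2) (Var 3)) (QImp (QLt (Var 3) (Var 4))
      (QImp (rel_at 4 (Var 1) (Var 2)) (QImp (rel_at 4 (Var 1) (Var 4))
        (rel_at 4 (Var 1) (Var 3))))))))))
  (QAll (Var 0) (QAll (Var 0) (QImp (QNot (QEq (Var 1) (Var 2)))
    (QImp (QNot (rel_at 0 (Var 1) (Num 0))) (QImp (QNot (rel_at 0 (Var 2) (Num 0)))
      (let meet := QEx (Len false) (QAnd (rel_at 4 (Var 1) (Var 3)) (rel_at 4 (Var 2) (Var 3)))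
       in QAnd (QImp (adj_at (Var 1) (Var 2)) meet) (QImp meet (adj_at (Var 1) (Var 2)))))))))).

Definition membership_query :=
  QEx side (QAnd (QAnd shape_query split_query) (QAnd budget_query interval_query)).

Definition table (s : nat) (w : word) r a b := nth false w ((r * (s + 1) + a) * (s + 1) + b).

Lemma ask_membership x w :
  ask [:: x; w] [::] membership_query <->
  exists2 n, n < size x + 1 & certified x n (table (size x) w).
Proof.
split.
  move=> /someP[n nx]; rewrite [rcons _ _]/=.
  move=> /andP[/andP[H1 H2] /andP[H3 H4]]; exists n => //.
  move: H1 => /= /andP[/everyP S1 /andP[S2 /andP[S3 /everyP S4]]].
  move: H2 => /= /everyP H2.
  have {}H2 u v un vn := everyP _ _ (H2 u un) v vn.
  move: H3 => /= /andP[/everyP B1 /andP[/everyP B2 /everyP B3]].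
  move: H4 => /= /andP[/everyP I1 /andP[/everyP I2 /everyP I3]].
  split=> //.
  - by move=> i ix e; apply: (implyP (S4 i ix)); apply/eqP.
  - by move=> u v un vn; case/and4P: (H2 u v un vn) => /implyP.
  - by move=> u un; case/and4P: (H2 u u un un).
  - move=> u v un vn uv ru rv; case/and4P: (H2 u v un vn) => _ _ /implyP H _.
    by apply: (implyP (implyP (H _) ru) rv); apply/eqP.
  - move=> u v un vn ru rv; case/and4P: (H2 u v un vn) => _ _ _ /implyP H.
    exact: (implyP (H ru) rv).
  - by move=> u un ru; apply/someP; apply: (implyP (B1 u un)).
  - move=> u v j un vn jn ru rv; apply/eqP.
    exact: (implyP (implyP (everyP _ _ (everyP _ _ (B2 u un) v vn) j jn) ru) rv).
  - move=> i j ix jn oi rij j0; apply/someP.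
    exact: (implyP (implyP (implyP (everyP _ _ (B3 i ix) j jn) oi) rij) j0).
  - by move=> u un ru; apply/someP; apply: (implyP (I1 u un)).
  - move=> u p q r un px qx rx pq qr up ur.
    have /everyP/(_ p px)/everyP/(_ q qx)/everyP/(_ r rx)/implyP H := I2 u un.
    exact: (implyP (implyP (implyP (H pq) qr) up) ur).
  - move=> u v un vn uv ru rv; have /everyP/(_ v vn)/implyP H := I3 u un.
    have /eqP uv' := uv; have /andP[/implyP H1 /implyP H2'] := implyP (implyP (H uv') ru) rv.
    by split=> [/H1/someP|/someP/H2'].
move=> [n nx C]; apply/someP; exists n => //; rewrite [rcons _ _]/=.
apply/andP; split; apply/andP; split => /=.
- apply/andP; split; first by apply/everyP => i; apply: cert_ones C _.
  rewrite (cert_zero C) (cert_size C); apply/everyP => i ix; apply/implyP => /eqP e.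
  exact: cert_last C _ ix e.
- apply/everyP => u un; apply/everyP => v vn; apply/and4P; split.
  + by apply/implyP => uv; apply: cert_sym C _ _ un vn uv.
  + exact: cert_irr C _ un.
  + apply/implyP => /eqP uv; apply/implyP => ru; apply/implyP => rv.
    exact: cert_clique C _ _ un vn uv ru rv.
  + by apply/implyP => ru; apply/implyP => rv; apply: cert_indep C _ _ un vn ru rv.
- apply/andP; split.
    by apply/everyP => u un; apply/implyP => ru; apply/someP; apply: cert_rank C _ un ru.
  apply/andP; split.
    apply/everyP => u un; apply/everyP => v vn; apply/everyP => j jn.
    apply/implyP => ru; apply/implyP => rv; apply/eqP.
    exact: cert_inj C _ _ _ un vn jn ru rv.
  apply/everyP => i ix; apply/everyP => j jn.
  apply/implyP => oi; apply/implyP => rij; apply/implyP => j0; apply/someP.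
  exact: cert_bits C _ _ ix jn oi rij j0.
- apply/andP; split.
    by apply/everyP => u un; apply/implyP => ru; apply/someP; apply: cert_point C _ un ru.
  apply/andP; split.
    apply/everyP => u un; apply/everyP => p px; apply/everyP => q qx; apply/everyP => r rx.
    apply/implyP => pq; apply/implyP => qr; apply/implyP => up; apply/implyP => ur.
    exact: cert_convex C _ _ _ _ un px qx rx pq qr up ur.
  apply/everyP => u un; apply/everyP => v vn; apply/implyP => /eqP uv.
  apply/implyP => ru; apply/implyP => rv; have [E1 E2] := cert_edge C un vn uv ru rv.
  by apply/andP; split; apply/implyP; [move=> /E1 /someP | move=> /someP /E2].
Qed.

Definition table_word (s : nat) (R : nat -> nat -> nat -> bool) : word :=
  mkseq (fun i => R (i %/ ((s + 1) * (s + 1))) (i %/ (s + 1) %% (s + 1)) (i %% (s + 1)))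
    (5 * ((s + 1) * (s + 1))).

Lemma table_wordE s R r a b : r < 5 -> a < s + 1 -> b < s + 1 ->
  table s (table_word s R) r a b = R r a b.
Proof.
move=> r5 aS bS; rewrite /table /table_word; move: (s + 1) aS bS => S aS bS.
have S0 : 0 < S by exact: leq_ltn_trans bS.
have e1 : ((r * S + a) * S + b) %/ S = r * S + a by rewrite divnMDl // divn_small ?addn0.
rewrite nth_mkseq; last by nia.
by rewrite divnMA e1 divnMDl // divn_small ?addn0 // !modnMDl !modn_small.
Qed.

(** The conditions only consult arguments below the radix, where the table agrees with [R]. *)
Lemma certified_table x n R :
  certified x n R -> certified x n (table (size x) (table_word (size x) R)).
Proof.
move=> C; have nx := cert_size C; have n_x : n < size x + 1 by lia.
have z : 0 < size x + 1 by lia.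
have R0 u : u < n -> table (size x) (table_word (size x) R) 0 u 0 = R 0 u 0.
  by move=> un; rewrite table_wordE //; lia.
have R1 u : u < n -> table (size x) (table_word (size x) R) 1 u 0 = R 1 u 0.
  by move=> un; rewrite table_wordE //; lia.
have R2 u j : u < n -> j < n -> table (size x) (table_word (size x) R) 2 u j = R 2 u j.
  by move=> un jn; rewrite table_wordE //; lia.
have R3 i j : i <= size x -> j <= n -> table (size x) (table_word (size x) R) 3 i j = R 3 i j.
  by move=> ix jn; rewrite table_wordE //; lia.
have R4 u p : u < n -> p < size x -> table (size x) (table_word (size x) R) 4 u p = R 4 u p.
  by move=> un px; rewrite table_wordE //; lia.
case: C => c1 c2 c3 c4 c5 c6 c7 c8 c9 c10 c11 c12 c13 c14; split=> //.
- by move=> u v un vn uv; rewrite !R1 //; apply: c7.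
- by move=> u v un vn; rewrite !R1 //; apply: c8.
- move=> u un; rewrite R0 // => /(c9 u un)[j jn] Hj; exists j => //.
  by rewrite R2 // R3 //; lia.
- by move=> u v j un vn jn; rewrite !R2 //; apply: c10.
- move=> i j ix jn oi; rewrite R3 //; [|lia|lia] => rij j0.
  have [j' j'n H] := c11 i j ix jn oi rij j0; exists j' => //.
  by rewrite R3 //; lia.
- by move=> u un; rewrite R0 // => /(c12 u un)[p px H]; exists p => //; rewrite R4.
- by move=> u p q r un px qx rx; rewrite !R4 //; apply: c13.
- move=> u v un vn uv; rewrite !R0 // => ru rv; rewrite c14 //.
  by split=> -[p px H]; exists p => //; move: H; rewrite !R4.
Qed.

(** * Encoded graphs and their certificates *)

Lemma enum_rankP (T : finType) a : a < #|T| -> exists u : T, a = enum_rank u.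
Proof. by move=> aT; exists (enum_val (Ordinal aT)); rewrite enum_valK. Qed.

Lemma exists_enum_rank (T : finType) (P : pred T) (u : T) :
  [exists v, (enum_rank v == enum_rank u :> nat) && P v] = P u.
Proof.
apply/existsP/idP => [[v /andP[/eqP /val_inj /enum_rank_inj -> //]]|Pu].
by exists u; rewrite eqxx.
Qed.

Lemma size_bits_gt0 k : 0 < k -> 0 < size (bits k).
Proof. by move=> k0; rewrite bits_half. Qed.

Lemma last_bits k : 0 < k -> last false (bits k).
Proof.
elim/ltn_ind: k => k IH k0; rewrite bits_half //=.
have [e|h0] := posnP k./2; last first.
  have hk : k./2 < k by lia.
  by have := IH _ hk h0; have := size_bits_gt0 h0; case: (bits _).
by rewrite e /=; have -> : k = 1 by lia.
Qed.

Lemma encode_bits (G : sgraph) k : 0 < k -> encode G k =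
  nseq #|G| true ++ false :: [seq edge u v | u <- enum G, v <- enum G] ++ bits k.
Proof. by case: k. Qed.

(** Since j is at most n, the bound required of the remaining digits may be capped at n. Thus no
    value above n has to be named, however large k is. *)
Lemma double_cap n v j (b : bool) : j < n + 1 -> j <= b + v.*2 ->
  (j <= 2 * minn n v) || b && (j <= 2 * minn n v + 1).
Proof. by case: b => /=; lia. Qed.

Section EncodedGraph.
Variables (G : sgraph) (k : nat) (x : word).
Hypotheses (k0 : 0 < k) (xE : x = encode G k).
Local Notation n := #|G|.
Local Notation M := [seq edge u v | u <- enum G, v <- enum G].

Let size_M : size M = n * n.
Proof. by rewrite size_allpairs -!cardE. Qed.

Let xE' : x = (nseq n true ++ [:: false]) ++ M ++ bits k.
Proof. by rewrite xE encode_bits // -catA. Qed.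

Let size_pre : size (nseq n true ++ [:: false]) = n + 1.
Proof. by rewrite size_cat size_nseq. Qed.

Lemma size_encode : size x = n + 1 + n * n + size (bits k).
Proof. by rewrite xE' size_cat size_pre size_cat size_M addnA. Qed.

Lemma nth_encode_ones i : i < n -> nth false x i.
Proof.
move=> i_n; rewrite xE' nth_cat size_pre ltn_addr // nth_cat size_nseq i_n.
by rewrite nth_nseq i_n.
Qed.

Lemma nth_encode_zero : nth false x n = false.
Proof.
by rewrite xE' nth_cat size_pre addn1 ltnS leqnn nth_cat size_nseq ltnn subnn.
Qed.

Lemma drop_encode : drop (n + 1 + n * n) x = bits k.
Proof. by rewrite xE' -{1}size_pre -size_M catA -size_cat drop_size_cat. Qed.

Lemma adj_encode (u v : G) : adj x n (enum_rank u) (enum_rank v) = edge u v.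
Proof.
rewrite /adj xE' nth_cat size_pre ltnNge leq_addr /= addKn.
have un : enum_rank u < n := ltn_ord _; have vn : enum_rank v < n := ltn_ord _.
have lt : enum_rank u * n + enum_rank v < n * n by nia.
rewrite nth_cat size_M lt.
rewrite {2}cardE (nth_allpairs _ u v) -?cardE //.
by rewrite !nth_enum_rank.
Qed.

Lemma certified_encode (R : realType) (K V : {set G}) :
  is_clique K -> is_independent (~: K) -> #|V| <= k ->
  interval_graph R (del_vertices V) -> exists C, certified x n C.
Proof.
move=> Kc Ki Vk HI.
have sx := size_encode; have sb := size_bits_gt0 k0.
have [|A [Ane Acvx Aedge]] := @interval_point_model R (del_vertices V) (size x) _ HI.
  rewrite card_sig; have : #|[pred u | u \in ~: V]| <= #|G| by exact: max_card.
  by move: #|[pred u | _]| => m mn; apply: leq_trans (leq_mul mn mn) _; rewrite sx addnAC leq_addl.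
pose alive (P : del_vertices V -> bool) (u : G) :=
  if insub u is Some u' then P u' else false.
pose C r a b := match r with
  | 0 => [exists u, (enum_rank u == a :> nat) && (u \in V)]
  | 1 => [exists u, (enum_rank u == a :> nat) && (u \in K)]
  | 2 => [exists u, (enum_rank u == a :> nat) && ((u \in V) && (index u (enum V) == b))]
  | 3 => b <= bval (drop a x)
  | _ => [exists u, (enum_rank u == a :> nat) && alive (A^~ b) u] end.
have C0 u : C 0 (enum_rank u) 0 = (u \in V) := exists_enum_rank (fun u => u \in V) u.
have C1 u : C 1 (enum_rank u) 0 = (u \in K) := exists_enum_rank (fun u => u \in K) u.
have C2 u j : C 2 (enum_rank u) j = (u \in V) && (index u (enum V) == j).
  exact: exists_enum_rank (fun u => (u \in V) && (index u (enum V) == j)) u.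
have C4 u p : C 4 (enum_rank u) p = alive (A^~ p) u.
  exact: exists_enum_rank (fun u => alive (A^~ p) u) u.
have aliveE (u : del_vertices V) P : alive P (val u) = P u.
  by rewrite /alive valK.
have lift u : u \notin V -> exists u' : del_vertices V, u = val u'.
  by move=> uV; have uV' : u \in ~: V by [rewrite inE]; exists (exist _ u uV').
have rank_neq (u v : G) : enum_rank u <> enum_rank v :> nat -> u <> v by move=> H e; rewrite e in H.
exists C; split.
- exact: nth_encode_ones.
- by rewrite nth_encode_zero.
- by rewrite sx; lia.
- move=> i ix e; have -> : i = n + 1 + n * n + (size (bits k)).-1 by lia.
  rewrite -nth_drop drop_encode nth_last.
  by have := last_bits k0; case: (bits k) sb.
- move=> a b /enum_rankP[u ->] /enum_rankP[v ->].
  by rewrite !adj_encode edge_sym.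
- by move=> a /enum_rankP[u ->]; rewrite adj_encode edge_irrefl.
- move=> a b /enum_rankP[u ->] /enum_rankP[v ->] /rank_neq/eqP uv.
  by rewrite !C1 adj_encode => uK vK; apply: Kc.
- move=> a b /enum_rankP[u ->] /enum_rankP[v ->].
  by rewrite !C1 adj_encode => uK vK; apply: Ki; rewrite inE.
- move=> a /enum_rankP[u ->]; rewrite C0 => uV.
  have iV : index u (enum V) < #|V| by rewrite cardE index_mem mem_enum.
  exists (index u (enum V)); first exact: leq_trans iV (max_card _).
  rewrite C2 uV eqxx [C 3 _ _]/= drop_encode bval_bits addn1.
  exact: leq_trans iV Vk.
- move=> a b j /enum_rankP[u ->] /enum_rankP[v ->] _; rewrite !C2.
  move=> /andP[uV /eqP <-] /andP[vV /eqP e].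
  suff -> : u = v by [].
  have := nth_index u (s := enum V) (x := u); rewrite mem_enum => /(_ uV) <-.
  by rewrite -e nth_index // mem_enum.
- move=> i j ix jn _; rewrite [C 3 _ _]/= (drop_nth false) //= => Hj j0.
  exists (minn n (bval (drop i.+1 x))); first by rewrite addn1 ltnS geq_minl.
  apply/andP; split; first exact: double_cap.
  have [ix1|xi] := ltnP (i + 1) (size x).
    by rewrite /= addn1 geq_minr orbT.
  by rewrite drop_oversize ?minn0 // -addn1.
- move=> a /enum_rankP[u ->]; rewrite C0 => /lift[u' ->].
  by have [p px Ap] := Ane u'; exists p; rewrite // C4 aliveE.
- move=> a p q r /enum_rankP[u ->] px qx rx pq qr; rewrite !C4 /alive.
  case: insubP => // u' _ _ Ap Ar.
  by apply: Acvx Ap Ar; rewrite // pq qr.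
- move=> a b /enum_rankP[u ->] /enum_rankP[v ->] /rank_neq uv; rewrite !C0 adj_encode.
  move=> /lift[u' eu] /lift[v' ev]; subst u v.
  have uv' : u' <> v' by move=> e; apply: uv; rewrite e.
  rewrite -[edge _ _]/(@edge (del_vertices V) u' v') Aedge //.
  by split=> -[p px H]; exists p => //; move: H; rewrite !C4 !aliveE => /andP.
Qed.

End EncodedGraph.

(** Each use of [cert_bits] consumes one digit, so induction on the rest of the word shows that
    relation 3 never claims more than the binary value. Past the last digit only 0 can be
    claimed. *)
Lemma bval_drop x n (C : nat -> nat -> nat -> bool) : certified x n C ->
  forall i j, n + 1 + n * n <= i <= size x -> j < n + 1 ->
  (i < size x -> C 3 i j) -> (i = size x -> j = 0) -> j <= bval (drop i x).
Proof.
move=> H i; have [m] := ubnP (size x - i); elim: m i => // m IH i im j /andP[oi].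
rewrite leq_eqVlt => /orP[/eqP ix _ _ -> //|ix jn /(_ ix) Cij _].
have [-> //|j0] := posnP j.
have [j' j'n /andP[Hj' Hj0]] := cert_bits H ix jn oi Cij j0.
rewrite (drop_nth false) //=.
suff : j' <= bval (drop i.+1 x) by case: (nth _ _ _) Hj' => /=; lia.
rewrite -addn1; case/orP: Hj0 => [/eqP -> //|/andP[ix1 C']].
by apply: IH => //; lia.
Qed.

(** The graph is rebuilt on ['I_n], whose enumeration is the natural order, so that encoding it
    again returns the very word [x]. *)
Lemma certified_split (R : realType) x n (C : nat -> nat -> nat -> bool) :
  certified x n C -> split_to_interval R x.
Proof.
move=> H; have nx := cert_size H; set o := n + 1 + n * n in nx.
pose e (u v : 'I_n) := adj x n u v.
have e_sym : symmetric e.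
  by move=> u v; apply/idP/idP; apply: cert_sym H _ _ (ltn_ord _) (ltn_ord _).
have e_irr : irreflexive e by move=> u; apply/negbTE/(cert_irr H)/ltn_ord.
pose G := SGraph e_sym e_irr.
have last_x : last true (drop o x).
  rewrite (last_nth true); have := size_drop o x; case ed: (drop o x) => [|b s] //= se.
  have -> : nth true (b :: s) (size s) = nth false (b :: s) (size s) by exact: set_nth_default.
  by rewrite -ed nth_drop; apply: (cert_last H); lia.
pose k := bval (drop o x).
have bk : bits k = drop o x by exact: bits_bval.
have k0 : 0 < k.
  by rewrite lt0n; apply/eqP => k0; move: bk; rewrite k0 => /(congr1 size); rewrite size_drop /=; lia.
have cG : #|G| = n by exact: card_ord.
have xE : x = encode G k.
  have sE := size_encode k0 (erefl (encode G k)).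
  apply: (@eq_from_nth _ false); first by rewrite sE cG bk size_drop; lia.
  move=> i ix; have [i_n|ni] := ltnP i n.
    by rewrite (cert_ones H i_n) (nth_encode_ones k0 (erefl _)) ?cG.
  move: ni; rewrite leq_eqVlt => /orP[/eqP <-|ni].
    by rewrite -{2}cG (nth_encode_zero k0 (erefl _)); apply/negbTE/(cert_zero H).
  have [io|oi] := ltnP i o; last first.
    rewrite -(subnKC oi) -!nth_drop -bk.
    by have := drop_encode k0 (erefl (encode G k)); rewrite cG => ->.
  have n0 : 0 < n by move: io ni; rewrite /o; case: (n) => //; lia.
  have un : (i - (n + 1)) %/ n < n by rewrite ltn_divLR //; move: io; rewrite /o; lia.
  have vn : (i - (n + 1)) %% n < n by rewrite ltn_mod.
  have := adj_encode k0 (erefl (encode G k)) (Ordinal un) (Ordinal vn).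
  rewrite !enum_rank_ord /= cG /e /adj /= -divn_eq => E.
  by move: E; rewrite subnKC //; lia.
exists G, k; split=> //.
  exists [set u : G | C 1 u 0]; split.
    move=> u v; rewrite !inE => uC vC uv.
    by apply: (cert_clique H) => //; apply/eqP.
  by move=> u v; rewrite !inE => uC vC; apply: (cert_indep H).
exists [set u : G | C 0 u 0]; split.
  (* The ranks inject the deleted set into ['I_k]; the other vertices get the dummy value 0, which
     exists because k is positive. *)
  have rank (u : G) : exists j : 'I_k, C 0 u 0 -> j < n /\ C 2 u j.
    have [Cu|] := boolP (C 0 u 0); last by exists (Ordinal k0).
    have [j jn /andP[Cj Ck]] := cert_rank H (ltn_ord u) Cu.
    have jk : j < k.
      by rewrite -addn1; apply: (bval_drop H) => //; rewrite -/o; lia.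
    by exists (Ordinal jk).
  have [f Hf] := fin_all_exists rank.
  rewrite -[k]card_ord -(card_in_imset (f := f)); first exact: max_card.
  move=> u v; rewrite !inE => /Hf[fn Cu] /Hf[_ Cv] fuv; apply/val_inj.
  by apply: (cert_inj H (ltn_ord u) (ltn_ord v) fn Cu); rewrite fuv.
apply: (@point_model_interval R (del_vertices [set u : G | C 0 u 0])
  (fun u p => is_true (C 4 (val (val u)) p)) (size x)).
have dead (u : del_vertices [set u : G | C 0 u 0]) : ~~ C 0 (val (val u)) 0.
  by have := valP u; rewrite !inE.
split.
- by move=> u; apply: (cert_point H (ltn_ord _) (dead u)).
- move=> u p q r /andP[pq qr] rm Ap Ar.
  by apply: (cert_convex H (ltn_ord _) _ _ rm pq qr Ap Ar); lia.
- move=> u v uv.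
  have uv' : val (val u) <> val (val v) by move=> /val_inj/val_inj.
  have := cert_edge H (ltn_ord _) (ltn_ord _) uv' (dead u) (dead v) => E.
  rewrite -[edge u v]/(adj x n (val (val u)) (val (val v))) E.
  by split=> -[p px] => [/andP|/andP]; exists p.
Qed.

Lemma split_to_interval_in_NP (R : realType) : in_NP (split_to_interval R).
Proof.
(* The length of [table_word]: five relations on pairs below the radix. *)
pose q : {poly nat} := (5%:P * (('X + 1%:P) * ('X + 1%:P)))%R.
have qE n : (q.[n])%R = 5 * ((n + 1) * (n + 1)).
  by rewrite /q !(hornerM, hornerD, hornerX, hornerC).
apply: (@formula_in_NP _ (core membership_query) q) => x; rewrite qE; split.
  move=> [G [k [xE [K [Kc Ki]] k0 [V [Vk HI]]]]].
  have [C HC] := certified_encode k0 xE Kc Ki Vk HI.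
  exists (table_word (size x) C); first by rewrite size_mkseq.
  rewrite holds_core; apply/ask_membership; exists #|G|; last exact: certified_table.
  by have := cert_size HC; lia.
by move=> [w _]; rewrite holds_core => /ask_membership[n _ /certified_split].
Qed.

(* Rows of side true sit on points left of the middle in the order of their rank, rows of
   side false symmetrically on the right, and every clique vertex covers the middle. *)
Lemma two_chains_interval (R : realType) (G : sgraph) (K : pred G)
    (thr : bool -> G -> nat) (sd : G -> option bool) (rk : G -> nat) top :
  (forall s v, thr s v <= top) -> (forall v, rk v < top) ->
  (forall u v, u != v -> K u -> K v -> edge u v) ->
  (forall u v, ~~ K u -> ~~ K v -> ~~ edge u v) ->
  (forall u v, K u -> ~~ K v -> edge u v = if sd v is Some s then thr s u <= rk v else false) ->
  interval_graph R G.
Proof.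
move=> thr_top rk_top KK RR KR.
pose w := #|G|; pose id (v : G) : nat := enum_rank v.
have id_w v : id v < w by exact: ltn_ord.
have id_inj u v : id u = id v -> u = v by move=> /val_inj/enum_rank_inj.
pose mid := top * w.
(* Ties in rank are broken by the enumeration index, so distinct rows get distinct points, while
   thresholds fall on multiples of [w] only. *)
pose pt v := rk v * w + id v.
have pt_mid v : pt v < mid.
  rewrite /pt /mid; apply: leq_trans (leq_mul (rk_top v) (leqnn w)).
  by rewrite mulSn addnC ltn_add2r.
have thr_pt s u v : (thr s u * w <= pt v) = (thr s u <= rk v).
  rewrite /pt; have := id_w v; move: (thr s u) (rk v) => a b iw.
  have w0 : 0 < w by exact: leq_ltn_trans iw.
  by rewrite -leq_divRL // divnMDl // divn_small // addn0.
have pt_inj u v : pt u = pt v -> u = v.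
  move=> e; apply: id_inj; have := congr1 (modn^~ w) e.
  by rewrite /pt !modnMDl !modn_small.
have thr_mid s v : thr s v * w <= mid by rewrite leq_mul2r thr_top orbT.
(* Rows without a side go beyond the right end of every clique interval. *)
pose pos v := match sd v with
  | Some true => pt v | Some false => mid.*2 - pt v | None => mid.*2 + 1 + id v end.
pose lo v := if K v then thr true v * w else pos v.
pose hi v := if K v then mid.*2 - thr false v * w else pos v.
have KRpos u v : K u -> ~~ K v -> edge u v = (lo u <= pos v <= hi u).
  move=> Ku Kv; rewrite (KR _ _ Ku Kv) /lo /hi /pos Ku.
  have := thr_mid true u; have := thr_mid false u; have := pt_mid v.
  case: (sd v) => [[]|]; rewrite -?thr_pt; lia.
have loN v : ~~ K v -> lo v = pos v by rewrite /lo => /negPf ->.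
have hiN v : ~~ K v -> hi v = pos v by rewrite /hi => /negPf ->.
apply: (@interval_graph_nat R G lo hi).
  by move=> v; rewrite /lo /hi; have := thr_mid true v; have := thr_mid false v; case: ifP; lia.
move=> u v uv; have [Ku|Ku] := boolP (K u); have [Kv|Kv] := boolP (K v).
- rewrite KK // /lo /hi Ku Kv.
  have := thr_mid true u; have := thr_mid false u.
  by have := thr_mid true v; have := thr_mid false v; lia.
- by rewrite KRpos // (loN v) // (hiN v).
- by rewrite edge_sym KRpos // (loN u) // (hiN u) // andbC.
- rewrite (negPf (RR _ _ Ku Kv)) /lo /hi (negPf Ku) (negPf Kv) -eqn_leq.
  apply/esym/negbTE/eqP; move/eqP: uv => uv.
  have := pt_mid u; have := pt_mid v; rewrite /pos.
  have np : pt u <> pt v by move=> /pt_inj.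
  have ni : id u <> id v by move=> /id_inj.
  by case: (sd u) => [[]|]; case: (sd v) => [[]|]; lia.
Qed.

(** * From a constraint satisfaction problem to interval deletion *)

Section Reduction.
Variables (R : realType) (D : finType) (d0 : D) (W : nat).

(* A binary constraint problem on the grid: each variable has a left and a right copy, with
   values in D. [Some (dt, dj)] constrains the left copy at (t, j) and the right copy at
   (t + dt, j + dj); [None] the left copy at (t, j + 1) and the right copy at (t + 1, j). *)
Definition ckind : finType := option (bool * bool).

(* [inl (c, a, b)]: a column, a clique vertex asserting that constraint c is met by the
   values a and b. [inr (inl s)]: a clique vertex seen by all rows of side s (true is left).
   [inr (inr (inl z))]: for [z = Some s] the row that sees only these vertices, for
   [z = None] the row that sees the columns violating their constraint.
   [inr (inr (inr (s, d)))]: the row of the s-copy of a grid variable for the value d; it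
   sees the columns at smaller variables and those at its own variable with value d.
   Except for columns, the last coordinate of a vertex numbers [budget + 1] twins, so that
   one of them survives the deletion. *)
Definition kind : finType := ((ckind * D * D) + (bool + (option bool + bool * D)))%type.

Variable allowed : ckind -> nat -> nat -> D -> D -> bool.

Definition grid_index t j := t * W.+1 + j.

Definition pos (s : bool) (c : ckind) t j :=
  match c with
  | Some (dt, dj) => if s then grid_index t j else grid_index (t + dt) (j + dj)
  | None => if s then grid_index t (j + 1) else grid_index (t + 1) j
  end.

Definition satisfied (valL valR : nat -> D) := forall c t j, t < W -> j < W ->
  allowed c t j (valL (pos true c t j)) (valR (pos false c t j)).

(** There are five kinds of constraints, each at [W * W] places, and all pairs of values but one are
    to be deleted for each. *)
Definition budget := 5 * (#|D| * #|D| - 1) * (W * W).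

(* Columns with m <> 0, or on the border of the grid, are isolated vertices. *)
Definition in_clique (x : kind) t j m :=
  match x with
  | inl _ => [&& t < W, j < W & m == 0]
  | inr (inl _) => true
  | _ => false
  end.

Definition meets (x : kind) t j (y : kind) t' j' :=
  match x, y with
  | inl (c, a, b), inr (inr (inl z)) => (z == None) && ~~ allowed c t j a b
  | inl (c, a, b), inr (inr (inr (s, d))) =>
      allowed c t j a b && ((pos s c t j < grid_index t' j')
        || (pos s c t j == grid_index t' j') && ((if s then a else b) == d))
  | inr (inl s), inr (inr (inl z)) => z == Some s
  | inr (inl s), inr (inr (inr (s', _))) => s == s'
  | _, _ => false
  end.

Definition joined (x : kind) t j m (y : kind) t' j' m' :=
  if in_clique x t j m then
    if in_clique y t' j' m' then [|| x != y, t != t', j != j' | m != m']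
    else meets x t j y t' j'
  else in_clique y t' j' m' && meets y t' j' x t j.

(** All kinds share the same coordinates, so that enumerating the vertices is a nest of loops whose
    bounds depend on [W] and [D] only. *)
Definition gvertex : finType := (kind * 'I_W.+1 * 'I_W.+1 * 'I_budget.+1)%type.

Definition gedge : rel gvertex := fun u v =>
  let: (x, t, j, m) := u in let: (y, t', j', m') := v in joined x t j m y t' j' m'.

Lemma gedge_sym : symmetric gedge.
Proof.
move=> [[[x t] j] m] [[[y t'] j'] m']; rewrite /gedge /joined.
case: ifP => //= _; case: ifP => //= _.
by rewrite (eq_sym x) (eq_sym (nat_of_ord t)) (eq_sym (nat_of_ord j)) (eq_sym (nat_of_ord m)).
Qed.

Lemma gedge_irrefl : irreflexive gedge.
Proof. by move=> [[[x t] j] m]; rewrite /gedge /joined !eqxx; case: (in_clique _ _ _ _). Qed.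

Definition ggraph := SGraph gedge_sym gedge_irrefl.

Definition gclique (v : gvertex) := let: (x, t, j, m) := v in in_clique x t j m.
Definition gmeets (u v : gvertex) :=
  let: (x, t, j, m) := u in let: (y, t', j', m') := v in meets x t j y t' j'.

Lemma gedge_clique u v : u != v -> gclique u -> gclique v -> gedge u v.
Proof.
case: u v => [[[x t] j] m] [[[y t'] j'] m'] /= uv Ku Kv.
rewrite /joined Ku Kv; apply: contraNT uv; rewrite !negb_or !negbK.
by case/and4P => /eqP-> /eqP/val_inj-> /eqP/val_inj-> /eqP/val_inj->.
Qed.

Lemma gedge_indep u v : ~~ gclique u -> ~~ gclique v -> ~~ gedge u v.
Proof.
case: u v => [[[x t] j] m] [[[y t'] j'] m'] /= Ku Kv.
by rewrite /joined (negPf Ku) (negPf Kv).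
Qed.

Lemma gedge_meets u v : gclique u -> ~~ gclique v -> gedge u v = gmeets u v.
Proof.
case: u v => [[[x t] j] m] [[[y t'] j'] m'] /= Ku Kv.
by rewrite /joined Ku (negPf Kv).
Qed.

Lemma ggraph_split : split_graph ggraph.
Proof.
exists [set v : ggraph | gclique v]; split=> u v; rewrite !inE.
  by move=> Ku Kv uv; apply: gedge_clique.
exact: gedge_indep.
Qed.

Definition column : finType := (ckind * D * D * 'I_W * 'I_W)%type.
Definition constraint : finType := (ckind * 'I_W * 'I_W)%type.

Definition vertex_of (x : column) : gvertex :=
  let: (c, a, b, t, j) := x in
  (inl (c, a, b), widen_ord (leqnSn W) t, widen_ord (leqnSn W) j, ord0).

Lemma vertex_of_inj : injective vertex_of.
Proof.
move=> [[[[c a] b] t] j] [[[[c' a'] b'] t'] j'] /= [-> -> -> et ej].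
by congr (_, _, _, _, _); apply: val_inj.
Qed.

Lemma card_constraint : #|constraint| = 5 * (W * W).
Proof. by rewrite !card_prod card_option card_prod card_bool !card_ord mulnA. Qed.

Lemma card_column : #|column| = budget + #|constraint|.
Proof.
have D0 : 0 < #|D| by apply/card_gt0P; exists d0.
rewrite card_constraint /budget -mulnDl -[X in _ + X]muln1 -mulnDr subnK ?muln_gt0 ?D0 //.
by rewrite !card_prod card_option card_prod card_bool !card_ord !mulnA.
Qed.

(** * From a small deletion set to a solution *)

Section Soundness.
Variable V : {set ggraph}.
Hypotheses (V_budget : #|V| <= budget) (V_interval : interval_graph R (del_vertices V)).

Lemma survivor x (t j : 'I_W.+1) : exists m, (x, t, j, m) \notin V.
Proof.
have [/existsP //|] := boolP [exists m, (x, t, j, m) \notin V].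
rewrite negb_exists => /forallP H; exfalso.
have: #|[set ((x, t, j, m) : ggraph) | m : 'I_budget.+1]| <= #|V|.
  by apply/subset_leq_card/subsetP => _ /imsetP[m _ ->]; have := H m; rewrite negbK.
rewrite card_imset ?card_ord; last by move=> m m' [].
by move=> /leq_trans/(_ V_budget); rewrite ltnn.
Qed.

Definition separated (a b : gvertex) :=
  exists2 c : gvertex, c \notin V & [&& gclique c, gmeets c a & ~~ gmeets c b].

Lemma no_antichain (a b c : gvertex) :
  a \notin V -> b \notin V -> c \notin V ->
  ~~ gclique a -> ~~ gclique b -> ~~ gclique c ->
  separated a b -> separated b a -> separated a c -> separated c a ->
  separated b c -> separated c b -> False.
Proof.
move=> aV bV cV Ka Kb Kc ab ba ac ca bc cb.
have rP (i : 'I_3) : [/\ nth a [:: a; b; c] i \in ~: V & ~~ gclique (nth a [:: a; b; c] i)].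
  by case: i => -[|[|[|]]] //= _; rewrite inE.
pose r (i : 'I_3) : del_vertices V := exist _ (nth a [:: a; b; c] i) (rP i).1.
have sep (i j : 'I_3) : i != j -> separated (val (r i)) (val (r j)).
  by case: i => -[|[|[|?]]] //= ?; case: j => -[|[|[|?]]] //= ?.
pose C := [set u : del_vertices V | gclique (val u)].
apply: (@interval_no_antichain R (del_vertices V) C _ r V_interval).
- by move=> u v; rewrite !inE => Ku Kv uv; apply: gedge_clique.
- by move=> i; rewrite inE; case: (rP i).
- move=> i j /sep[x xV /and3P[Kx mx nx]]; have xV' : x \in ~: V by rewrite inE.
  have [Ki Kj] := ((rP i).2, (rP j).2); split.
  + by apply/eqP => e; rewrite -e mx in nx.
  + exact: gedge_indep.
  + exists (exist _ x xV'); rewrite ?inE //.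
    rewrite -[edge _ (r i)]/(gedge x (val (r i))) -[edge _ (r j)]/(gedge x (val (r j))).
    by rewrite !gedge_meets.
Qed.

(** Among the three special rows, a violating column is seen by row [None] alone, and each vertex
    [Z s] by the row of side s alone: together they make the three rows an antichain. *)
Lemma column_allowed (x : column) : vertex_of x \notin V ->
  let: (c, a, b, t, j) := x in allowed c t j a b.
Proof.
move: x => [[[[c a] b] t] j] xV; apply/negPn/negP => bad.
pose z s : kind := inr (inr (inl s)); pose Z s : kind := inr (inl s).
have [m1 m1V] := survivor (z (Some true)) ord0 ord0.
have [m2 m2V] := survivor (z (Some false)) ord0 ord0.
have [m3 m3V] := survivor (z None) ord0 ord0.
have [n1 n1V] := survivor (Z true) ord0 ord0.
have [n2 n2V] := survivor (Z false) ord0 ord0.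
have X : [&& t < W, j < W & 0 == 0] by rewrite !ltn_ord.
apply: (no_antichain m1V m2V m3V) => //.
- by exists (Z true, ord0, ord0, n1).
- by exists (Z false, ord0, ord0, n2).
- by exists (Z true, ord0, ord0, n1).
- by exists (vertex_of (c, a, b, t, j)) => //; rewrite /= X bad.
- by exists (Z false, ord0, ord0, n2).
- by exists (vertex_of (c, a, b, t, j)) => //; rewrite /= X bad.
Qed.

(** Offsets by one lead from the [W] by [W] places of constraints at most to the border of the grid
    of side [W.+1]. *)
Lemma pos_grid s c (t j : 'I_W) : exists t' j' : 'I_W.+1, pos s c t j = grid_index t' j'.
Proof.
have [tW jW] := (ltn_ord t, ltn_ord j).
have t1 : t + 1 < W.+1 by lia.
have j1 : j + 1 < W.+1 by lia.
have in_t (b : bool) : t + b < W.+1 by case: b; lia.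
have in_j (b : bool) : j + b < W.+1 by case: b; lia.
case: c => [[dt dj]|]; case: s => /=.
- by exists (widen_ord (leqnSn W) t), (widen_ord (leqnSn W) j).
- by exists (Ordinal (in_t dt)), (Ordinal (in_j dj)).
- by exists (widen_ord (leqnSn W) t), (Ordinal j1).
- by exists (Ordinal t1), (widen_ord (leqnSn W) j).
Qed.

Definition value_of (s : bool) (x : column) : D :=
  let: (c, a, b, t, j) := x in if s then a else b.
Definition pos_of (s : bool) (x : column) : nat :=
  let: (c, a, b, t, j) := x in pos s c t j.

(* Otherwise the rows of the two values and the special row of the other side are
   pairwise incomparable. *)
Lemma column_consistent s (x y : column) : vertex_of x \notin V -> vertex_of y \notin V ->
  pos_of s x = pos_of s y -> value_of s x = value_of s y.
Proof.
move=> xV yV e; apply/eqP/negPn/negP => ne.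
have := column_allowed xV; have := column_allowed yV.
have [t' [j' et]] : exists t' j' : 'I_W.+1, pos_of s x = grid_index t' j'.
  by case: (x) => [[[[c a] b] t] j]; apply: pos_grid.
have ye : pos_of s y = grid_index t' j' by rewrite -e.
pose Z s : kind := inr (inl s).
have [m1 m1V] := survivor (inr (inr (inr (s, value_of s x)))) t' j'.
have [m2 m2V] := survivor (inr (inr (inr (s, value_of s y)))) t' j'.
have [m3 m3V] := survivor (inr (inr (inl (Some (~~ s))))) t' j'.
have [n1 n1V] := survivor (Z s) ord0 ord0.
have [n2 n2V] := survivor (Z (~~ s)) ord0 ord0.
have ns : (~~ s == s) = false by case: (s).
have sn : (Some (~~ s) == Some s) = false by case: (s).
have ne' : (value_of s y == value_of s x) = false by rewrite eq_sym; apply/negbTE.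
move: xV yV e ne et ye m1V m2V ne'.
move: x y => [[[[c a] b] t] j] [[[[c' a'] b'] t'' ] j''] xV yV e ne et ye m1V m2V ne' ay ax.
rewrite /= in e et ye ne ne'.
have X : [&& t < W, j < W & 0 == 0] by rewrite !ltn_ord.
have Y : [&& t'' < W, j'' < W & 0 == 0] by rewrite !ltn_ord.
apply: (no_antichain m1V m2V m3V) => //.
- exists (vertex_of (c, a, b, t, j)) => //.
  by rewrite /= X ax et ltnn eqxx /= eqxx (negPf ne).
- exists (vertex_of (c', a', b', t'', j'')) => //.
  by rewrite /= Y ay ye ltnn eqxx /= eqxx ne'.
- by exists (Z s, ord0, ord0, n1) => //=; rewrite eqxx sn.
- by exists (Z (~~ s), ord0, ord0, n2) => //=; rewrite eqxx ns.
- by exists (Z s, ord0, ord0, n1) => //=; rewrite eqxx sn.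
- by exists (Z (~~ s), ord0, ord0, n2) => //=; rewrite eqxx ns.
Qed.

Definition constraint_of (x : column) : constraint :=
  let: (c, a, b, t, j) := x in (c, t, j).

(* Pigeonhole: at most one column per constraint survives. *)
Lemma constraint_survives (y : constraint) :
  exists2 x, vertex_of x \notin V & constraint_of x = y.
Proof.
pose S := [set x : column | vertex_of x \notin V].
have inj : {in S &, injective constraint_of}.
  move=> x x'; rewrite !inE => xV x'V.
  have Ht := @column_consistent true _ _ xV x'V; have Hf := @column_consistent false _ _ xV x'V.
  move: x x' {xV x'V} Ht Hf => [[[[c a] b] t] j] [[[[c' a'] b'] t'] j'] /= Ht Hf [ec et ej].
  by subst c' t' j'; rewrite (Ht erefl) (Hf erefl).
have : #|constraint_of @: S| = #|constraint|.
  apply/eqP; rewrite eqn_leq max_card /= card_in_imset //.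
  rewrite -(leq_add2l budget) -card_column -(cardsC S) addnC leq_add2r.
  apply: leq_trans V_budget; rewrite -(card_imset _ vertex_of_inj).
  apply/subset_leq_card/subsetP => _ /imsetP[x xS ->].
  by move: xS; rewrite !inE negbK.
move=> e; have : y \in constraint_of @: S.
  by have /eqP -> : constraint_of @: S == setT; rewrite ?inE // eqEcard subsetT cardsT e /=.
by case/imsetP => x; rewrite inE => xV ->; exists x.
Qed.

Lemma reduction_sound : exists valL valR, satisfied valL valR.
Proof.
(* Surviving columns at the same position agree, so any of them defines the value; [d0] fills the
   positions that none reaches. *)
pose val s p := if [pick x : column | (vertex_of x \notin V) && (pos_of s x == p)] is Some x
  then value_of s x else d0.
have valE s (x : column) : vertex_of x \notin V -> val s (pos_of s x) = value_of s x.
  move=> xV; rewrite /val; case: pickP => [y /andP[yV /eqP e]|/(_ x)].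
    exact: column_consistent.
  by rewrite xV eqxx.
exists (val true), (val false) => c t j tW jW.
have [x xV e] := constraint_survives (c, Ordinal tW, Ordinal jW).
have := column_allowed xV; have := valE true _ xV; have := valE false _ xV.
by move: x e {xV} => [[[[c' a] b] t'] j'] /= [-> -> ->] /= -> ->.
Qed.

End Soundness.

(** * From a solution to a small deletion set *)

Lemma reduction_complete valL valR : satisfied valL valR ->
  exists V : {set ggraph}, #|V| <= budget /\ interval_graph R (del_vertices V).
Proof.
move=> sat; pose asg (s : bool) := if s then valL else valR.
pose good (x : column) := [forall s, value_of s x == asg s (pos_of s x)].
pose V : {set ggraph} := [set vertex_of x | x in [set x | ~~ good x]].
exists V; split.
  rewrite card_imset; last exact: vertex_of_inj.
  (* The column that a constraint keeps. There are as many of these as columns in excess of the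
     budget. *)
  pose sol (y : constraint) : column :=
    let: (c, t, j) := y in (c, asg true (pos true c t j), asg false (pos false c t j), t, j).
  have sol_inj : injective sol.
    by move=> [[c t] j] [[c' t'] j'] [-> _ _ -> ->].
  have : #|[set sol y | y in setT]| <= #|[set x | good x]|.
    apply/subset_leq_card/subsetP => _ /imsetP[[[c t] j] _ ->]; rewrite inE.
    by apply/forallP => -[] /=.
  rewrite card_imset // cardsT => le.
  have -> : [set x | ~~ good x] = ~: [set x | good x] by apply/setP => x; rewrite !inE.
  by rewrite -(leq_add2r #|constraint|) -card_column -(cardsC [set x | good x]) addnC leq_add2r.
pose top := 2 * (W.+1 * W.+1) + 2 + 2 * W.+1.
(* At variable p the row of the assigned value has rank 2p + 2 and the other rows have rank 2p + 1.
   A column at p starts at 2p + 2, so it meets all rows of later variables and, at p, that of the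
   assigned value only. *)
pose thr (s : bool) (u : gvertex) : nat := match u with
  | (inl (c, a, b), t, j, _) => minn top (2 * pos s c t j + 2)
  | (inr (inl s'), _, _, _) => if s == s' then 0 else top
  | _ => 0 end.
pose rk (u : gvertex) : nat := match u with
  | (inr (inr (inr (s, d))), t, j, _) => 2 * grid_index t j + 1 + (d == asg s (grid_index t j))
  | _ => 0 end.
(* Row [None] belongs to neither chain: every surviving column satisfies its constraint, so this row
   is isolated. *)
pose sd (u : gvertex) : option bool := match u with
  | (inr (inr (inl z)), _, _, _) => z
  | (inr (inr (inr (s, d))), t, j, _) => Some s
  | _ => None end.
have rk_top u : rk u < top.
  rewrite /rk /top; case: u => [[[[x|[s|[z|[s d]]]] t] j] m] //; try lia.
  have := ltn_ord t; have := ltn_ord j; rewrite /grid_index.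
  move: (nat_of_ord t) (nat_of_ord j) => a b bW aW.
  have : a * W.+1 <= W * W.+1 by rewrite leq_mul2r -ltnS aW orbT.
  by case: (_ == _) => /=; lia.
apply: (@two_chains_interval R (del_vertices V) (fun u => gclique (val u))
  (fun s u => thr s (val u)) (fun u => sd (val u)) (fun u => rk (val u)) top).
- by move=> s u; rewrite /thr; case: (val u) => [[[[[[c a] b]|[s'|y]] t] j] m]; rewrite ?geq_minl //; case: ifP.
- by move=> u; apply: rk_top.
- by move=> u v uv Ku Kv; apply: gedge_clique.
- by move=> u v Ku Kv; apply: gedge_indep.
move=> u v Ku Kv; rewrite -[edge u v]/(gedge (val u) (val v)) gedge_meets //.
have uV : val u \notin V by have := valP u; rewrite inE.
have rkv := rk_top (val v).
move: (val u) (val v) uV Ku Kv rkv => {u v} [[[x t] j] m] [[[y t'] j'] m'] uV Ku Kv rkv.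
case: x uV Ku => [[[c a] b]|[s|x]] //= uV Ku; last first.
  case: y Kv rkv => [[[c' a'] b']|[s'|[z|[s' d]]]] //= _ rkv.
    by case: z => [s'|] //; rewrite (inj_eq Some_inj) [RHS]leqn0 eq_sym; case: ifP.
  by rewrite eq_sym; case: ifP => _ //; apply/esym/negbTE; rewrite -ltnNge.
have /and3P[tW jW /eqP m0] := Ku.
pose col : column := (c, a, b, Ordinal tW, Ordinal jW).
have colE : vertex_of col = (inl (c, a, b), t, j, m).
  by congr (_, _, _, _); apply: val_inj.
have g : good col.
  by apply/negPn/negP => ng; move/negP: uV; apply; rewrite -colE; apply: imset_f; rewrite inE.
move/forallP: g => g; have /eqP ga := g true; have /eqP gb := g false.
rewrite /= in ga gb.
have ok : allowed c t j a b by rewrite ga gb; apply: sat.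
case: y Kv rkv => [[[c' a'] b']|[s'|[z|[s' d]]]] //= Kv rkv; rewrite ok /=.
  by rewrite andbF; case: z => // s; rewrite leqn0; apply/esym/negbTE; rewrite /top; lia.
rewrite geq_min [top <= _]leqNgt rkv /=.
have -> : (if s' then a else b) = asg s' (pos s' c t j) by case: (s').
set p := pos _ _ _ _; set p' := grid_index _ _ in rkv *.
have [e|/eqP ne] := eqVneq p p'.
  by rewrite e ltnn /= eq_sym; case: eqP rkv => _ /=; rewrite /top; lia.
by case: (d == _) rkv => /=; lia.
Qed.

End Reduction.

(** * Writing down the graph *)

Lemma enum_prod (A B : finType) :
  enum {: A * B} = [seq (a, b) | a <- enum A, b <- enum B].
Proof. by rewrite [LHS]enumT unlock. Qed.

(** Products are enumerated lexicographically, which is the order of nested loops. *)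
Lemma flatten_map_enum_prod (T : Type) (A B : finType) (F : A * B -> seq T) :
  flatten [seq F p | p <- enum {: A * B}]
  = flatten [seq flatten [seq F (a, b) | b <- enum B] | a <- enum A].
Proof.
rewrite enum_prod; elim: (enum A) => //= a s IH.
by rewrite map_cat flatten_cat IH -map_comp.
Qed.

Lemma map_enum_ord (T : Type) n (F : nat -> T) :
  [seq F i | i : 'I_n <- enum 'I_n] = [seq F i | i <- iota 0 n].
Proof. by rewrite -val_enum_ord -map_comp. Qed.

Definition seqs (cs : seq cmd) := foldr Seq Skip cs.

Lemma emits_seqs ws env cs : emits ws env (seqs cs) = flatten [seq emits ws env c | c <- cs].
Proof. by elim: cs => //= c cs ->. Qed.

Section Emit.
Variable D : finType.
Variables (W : word -> nat) (allowed : word -> ckind -> nat -> nat -> D -> D -> bool).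
Variables (Wq : expr) (allowedq : ckind -> D -> D -> expr -> expr -> query).
Hypothesis WqE : forall x env, value [:: x] env Wq = W x.
Hypothesis allowedqE : forall x env c a b t j, ask [:: x] env (allowedq c a b t j)
  = allowed x c (value [:: x] env t) (value [:: x] env j) a b.

Definition indexq t j := Add (Mul t (Add Wq (Num 1))) j.

Definition posq (s : bool) (c : ckind) t j :=
  match c with
  | Some (dt, dj) =>
      if s then indexq t j else indexq (Add t (Num (nat_of_bool dt))) (Add j (Num (nat_of_bool dj)))
  | None => if s then indexq t (Add j (Num 1)) else indexq (Add t (Num 1)) j
  end.

Definition in_cliqueq (x : kind D) t j m :=
  match x with
  | inl _ => QAnd (QLt t Wq) (QAnd (QLt j Wq) (QEq m (Num 0)))
  | inr (inl _) => QConst true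
  | _ => QConst false
  end.

Definition meetsq (x : kind D) t j (y : kind D) t' j' :=
  match x, y with
  | inl (c, a, b), inr (inr (inl z)) =>
      QAnd (QConst (z == None)) (QNot (allowedq c a b t j))
  | inl (c, a, b), inr (inr (inr (s, d))) =>
      QAnd (allowedq c a b t j) (QOr (QLt (posq s c t j) (indexq t' j'))
        (QAnd (QEq (posq s c t j) (indexq t' j')) (QConst ((if s then a else b) == d))))
  | inr (inl s), inr (inr (inl z)) => QConst (z == Some s)
  | inr (inl s), inr (inr (inr (s', _))) => QConst (s == s')
  | _, _ => QConst false
  end.

Definition joinedq (x : kind D) t j m (y : kind D) t' j' m' :=
  QOr (QAnd (in_cliqueq x t j m)
        (QOr (QAnd (in_cliqueq y t' j' m')
               (QNot (QAnd (QConst (x == y)) (QAnd (QEq t t') (QAnd (QEq j j') (QEq m m'))))))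
             (QAnd (QNot (in_cliqueq y t' j' m')) (meetsq x t j y t' j'))))
      (QAnd (QNot (in_cliqueq x t j m)) (QAnd (in_cliqueq y t' j' m') (meetsq y t' j' x t j))).

Definition budgetq := Mul (Num (5 * (#|D| * #|D| - 1))) (Mul Wq Wq).
Definition sideq := Add Wq (Num 1).
Definition copiesq := Add budgetq (Num 1).

(** The kinds are unrolled in the program text, since their number does not depend on the input;
    only the coordinates are looped over. *)
Definition matrix_cmd :=
  seqs [seq For sideq (For sideq (For copiesq (seqs
    [seq For sideq (For sideq (For copiesq (Out (core
      (joinedq x (Var 0) (Var 1) (Var 2) y (Var 3) (Var 4) (Var 5))))))
    | y <- enum (kind D)]))) | x <- enum (kind D)].

Definition encode_cmd :=
  Seq (For (Mul (Mul (Mul (Num #|kind D|) sideq) sideq) copiesq) (Out (FConst true)))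
    (Seq (Out (FConst false)) (Seq matrix_cmd (OutBin budgetq))).

Section Correct.
Variable x : word.
Local Notation ask := (ask [:: x]).
Local Notation value := (value [:: x]).

Lemma value_indexq env t j :
  value env (indexq t j) = grid_index (W x) (value env t) (value env j).
Proof. by rewrite /= WqE addn1. Qed.

Lemma value_posq env s c t j :
  value env (posq s c t j) = pos (W x) s c (value env t) (value env j).
Proof. by case: c => [[dt dj]|]; case: s; rewrite value_indexq. Qed.

Lemma ask_in_cliqueq env y t j m :
  ask env (in_cliqueq y t j m) = in_clique (W x) y (value env t) (value env j) (value env m).
Proof. by case: y => [?|[?|?]] //=; rewrite WqE. Qed.

Lemma ask_meetsq env y t j z t' j' : ask env (meetsq y t j z t' j')
  = meets (W x) (allowed x) y (value env t) (value env j) z (value env t') (value env j').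
Proof.
case: y => [[[c a] b]|[s|y]]; case: z => [[[c' a'] b']|[s'|[z|[s' d]]]] //.
  by rewrite /= allowedqE.
rewrite -[LHS]/(ask env (allowedq c a b t j)
  && ((value env (posq s' c t j) < value env (indexq t' j'))
    || (value env (posq s' c t j) == value env (indexq t' j')) && ((if s' then a else b) == d))).
by rewrite allowedqE value_posq value_indexq.
Qed.

Lemma ask_joinedq env y t j m z t' j' m' : ask env (joinedq y t j m z t' j' m')
  = joined (W x) (allowed x) y (value env t) (value env j) (value env m)
      z (value env t') (value env j') (value env m').
Proof.
rewrite -[LHS]/(ask env (in_cliqueq y t j m)
    && (ask env (in_cliqueq z t' j' m')
        && ~~ [&& y == z, value env t == value env t', value env j == value env j'
               & value env m == value env m']
      || ~~ ask env (in_cliqueq z t' j' m') && ask env (meetsq y t j z t' j'))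
  || ~~ ask env (in_cliqueq y t j m)
    && (ask env (in_cliqueq z t' j' m') && ask env (meetsq z t' j' y t j))).
rewrite !ask_in_cliqueq !ask_meetsq /joined.
by case: (in_clique _ y _ _ _); case: (in_clique _ z _ _ _); rewrite ?orbF //= !negb_and.
Qed.

Lemma emits_loops (F : gvertex D (W x) -> seq bool) (env : seq nat) (body : kind D -> cmd) :
  (forall (y : kind D) (t j : 'I_(W x).+1) (m : 'I_(budget D (W x)).+1),
    emits [:: x] (rcons (rcons (rcons env t) j) m) (body y) = F (y, t, j, m)) ->
  emits [:: x] env (seqs [seq For sideq (For sideq (For copiesq (body y))) | y <- enum (kind D)])
  = flatten [seq F u | u <- enum (gvertex D (W x))].
Proof.
move=> H; rewrite emits_seqs -map_comp !flatten_map_enum_prod; congr flatten.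
apply: eq_map => y /=; rewrite !WqE !addn1.
rewrite -(map_enum_ord (W x).+1 (fun t => flatten _)); congr flatten; apply: eq_map => t.
rewrite !WqE !addn1.
rewrite -(map_enum_ord (W x).+1 (fun j => flatten _)); congr flatten; apply: eq_map => j.
rewrite !WqE -[5 * _ * _]/(budget D (W x)) addn1.
rewrite -(map_enum_ord _ (fun m => emits _ _ _)); congr flatten; apply: eq_map => m.
exact: H.
Qed.

Lemma emits_encode : 0 < budget D (W x) ->
  emits [:: x] [::] encode_cmd = encode (ggraph (W x) (allowed x)) (budget D (W x)).
Proof.
move=> k0; rewrite encode_bits //; rewrite /encode_cmd.
have E : forall v, flatten [seq [:: true] | _ <- iota 0 v] = nseq v true.
  by move=> v; elim: v 0 => //= v IH m; rewrite IH.
rewrite [emits _ _ _]/= E !WqE.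
rewrite -[5 * _ * _]/(budget D (W x)) !addn1.
have -> : #|ggraph (W x) (allowed x)|
    = #|kind D| * (W x).+1 * (W x).+1 * (budget D (W x)).+1.
  by rewrite !card_prod !card_ord.
congr (_ ++ _ :: _ ++ _).
rewrite /matrix_cmd.
rewrite (@emits_loops (fun u => [seq gedge (allowed x) u v | v <- enum (gvertex D (W x))])) //.
move=> y t j m.
have -> : [seq gedge (allowed x) (y, t, j, m) v | v <- enum (gvertex D (W x))]
    = flatten [seq [:: gedge (allowed x) (y, t, j, m) v] | v <- enum (gvertex D (W x))].
  by elim: (enum _) => //= v s ->.
apply: emits_loops => z t' j' m'.
rewrite -[LHS]/[:: holds [:: x] [:: t : nat; j : nat; m : nat; t' : nat; j' : nat; m' : nat]
  (core (joinedq y (Var 0) (Var 1) (Var 2) z (Var 3) (Var 4) (Var 5)))].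
by rewrite holds_core ask_joinedq.
Qed.

End Correct.
End Emit.

(** * The computation tableau *)

Section Tableau.
Variable M : machine.

Definition letter : finType := option (bool + aux M).
Definition heads : finType := {ffun 'I_(tapes M).+1 -> letter}.
Definition cell : finType := {ffun 'I_(tapes M).+1 -> letter * letter}.

(* The tile at (t, j) records the state and all scanned letters at time t and, for every
   tape, the letters at distance j from the head: to its left and to its right. *)
Definition tile : finType := (state M * heads * cell)%type.
Implicit Types (a b : tile) (i : 'I_(tapes M).+1).

Definition state_of a := a.1.1.
Definition read_of a i := a.1.2 i.
Definition left_of a i := (a.2 i).1.
Definition right_of a i := (a.2 i).2.

(** Letting a halted machine idle makes a tableau of fixed height fit runs that halt early. *)
Definition move_of a :=
  if halting (state_of a) then (state_of a, a.1.2, fun=> Stay)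
  else transition (state_of a) a.1.2.
Definition next_state a := (move_of a).1.1.
Definition write_of a i := (move_of a).1.2 i.
Definition dir_of a i := (move_of a).2 i.

(* Only the scanned cell, at distance 0 on the right, is overwritten. *)
Definition right_after (j0 : bool) a i := if j0 then write_of a i else right_of a i.

Definition tile_of (c : config M) j : tile :=
  (c.1, [ffun i => tape_read (c.2 i)],
   [ffun i => (nth None (c.2 i).1 j, nth None (c.2 i).2 j)]).

Lemma next_stateE (c : config M) j : (step c).1 = next_state (tile_of c j).
Proof.
rewrite /step /next_state /move_of /state_of /=; case: ifP => //= _.
by case: (transition _ _) => [[q w] d].
Qed.

(** A move shifts the two half tapes by one in opposite directions. Each half of the new cell comes
    from one old cell at distance j - 1, j or j + 1, and what steers the move is stored in every
    tile; hence binary constraints suffice. *)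
Lemma step_tile (c : config M) i j :
  let a := tile_of c in
  (left_of (tile_of (step c) j) i, right_of (tile_of (step c) j) i) =
  match dir_of (a j) i with
  | Stay => (left_of (a j) i, right_after (j == 0) (a j) i)
  | GoRight => (if j is j'.+1 then left_of (a j') i else write_of (a j) i,
                right_of (a j.+1) i)
  | GoLeft => (left_of (a j.+1) i,
               if j is j'.+1 then right_after (j' == 0) (a j') i else left_of (a j) i)
  end.
Proof.
rewrite /= /left_of /right_of !ffunE /= /right_after /write_of /right_of /dir_of /move_of.
rewrite /state_of /= /step; case: ifP => hc /=.
  by rewrite !ffunE /tape_read; case: (c.2 i) => l [|s r]; case: j.
case: (transition _ _) => [[q w] d] /=; rewrite !ffunE /=.
case cE: (c.2 i) => [l r] /=; rewrite /tape_read /tape_write /tape_move /=.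
by case: (d i) => /=; case: j => [|[|j]] //=; rewrite ?ffunE ?cE /= ?nth_behead ?nth0.
Qed.

(** Tapes are named by a number because the machine may have no tape 1; the condition is then
    vacuous. *)
Definition on_tape n (P : pred letter) a := [forall i : 'I_(tapes M).+1, (i == n :> nat) ==> P (right_of a i)].

Definition is_bit (s : letter) := if s is Some (inr _) then false else true.

Definition first_row_fixed a :=
  [&& state_of a == start M, [forall i, left_of a i == None],
      on_tape 1 is_bit a & [forall i : 'I_(tapes M).+1, (1 < i) ==> (right_of a i == None)]].

Definition input_letter (x : word) j : letter :=
  if j < size x then Some (inl (nth false x j)) else None.

Definition first_row x Q j a :=
  [&& first_row_fixed a, right_of a ord0 == input_letter x j
    & (Q <= j) ==> on_tape 1 (pred1 None) a].

Definition head_row a := [forall i, right_of a i == read_of a i].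
Definition last_row a := halting (state_of a) && accepting (state_of a).
Definition same_row a b := a.1 == b.1.
(** Tape 1 is left free in the first row, which is how the certificate is guessed. No letter may
    follow a blank, so the guess is a word. *)
Definition contiguous a b := on_tape 1 (pred1 None) a ==> on_tape 1 (pred1 None) b.

(** The cases of [step_tile] are divided according to the source of the new letter: the same
    distance here, with the letters that cross or are written at the head, then one step nearer in
    [below_right] and one step farther in [below_left]. *)
Definition below j0 a b :=
  (state_of b == next_state a) && [forall i, match dir_of a i with
    | Stay => (left_of b i == left_of a i) && (right_of b i == right_after j0 a i)
    | GoRight => j0 ==> (left_of b i == write_of a i)
    | GoLeft => j0 ==> (right_of b i == left_of a i) end].

Definition below_right j0 a b := [forall i, match dir_of a i with
  | Stay => true
  | GoRight => left_of b i == left_of a i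
  | GoLeft => right_of b i == right_after j0 a i end].

Definition below_left a b := [forall i, match dir_of a i with
  | Stay => true
  | GoRight => right_of b i == right_of a i
  | GoLeft => left_of b i == left_of a i end].

(** The zero offset identifies the two copies of a variable and carries all conditions on a single
    tile. *)
Definition tableau x W Q (c : ckind) t j a b : bool :=
  match c with
  | Some (false, false) => [&& a == b, (j == 0) ==> head_row a,
      (t == 0) ==> first_row x Q j a & (t + 1 == W) ==> last_row a]
  | Some (false, true) => same_row a b && ((t == 0) ==> contiguous a b)
  | Some (true, false) => below (j == 0) a b
  | Some (true, true) => below_right (j == 0) a b
  | None => below_left a b
  end.

Section Correct.
Variables (x : word) (W Q : nat).
Hypothesis QW : Q < W.
Local Notation grid := (grid_index W).

Lemma tableau_complete w : size w <= Q -> accepts_in M W.-1 [:: x; w] ->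
  exists valL valR, satisfied W (tableau x W Q) valL valR.
Proof.
move=> wQ; rewrite /accepts_in.
have [c c0 cS] : exists2 c, c 0 = init M [:: x; w] & forall t, c t.+1 = step (c t).
  by exists (fun t => run M t [:: x; w]).
have -> : run M W.-1 [:: x; w] = c W.-1.
  by elim: (W.-1) => [|t IH]; rewrite ?c0 // cS -IH.
move=> [hW aW].
pose val p := tile_of (c (p %/ W.+1)) (p %% W.+1).
have valE t j : j <= W -> val (grid t j) = tile_of (c t) j.
  by move=> jW; rewrite /val /grid_index divnMDl // divn_small // addn0 modnMDl modn_small.
have step_c t i j := step_tile (c t) i j.
exists val, val => k t j tW jW.
case: k => [[dt dj]|] /=; rewrite !valE ?addn1 //; try solve [lia | case: (dj); lia].
case: dt; case: dj; rewrite ?addn0 ?addn1 /=.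
- apply/forallP => i; have := step_c t i j.+1; rewrite /= -cS.
  have -> : dir_of (tile_of (c t) j.+1) i = dir_of (tile_of (c t) j) i by [].
  by case: (dir_of _ i) => -[e1 e2]; rewrite ?e1 ?e2 //= eqxx.
- apply/andP; split; first by rewrite -next_stateE -cS.
  apply/forallP => i; have := step_c t i j; rewrite /= -cS.
  by case: (dir_of _ i) => -[e1 e2]; rewrite ?e1 ?e2 ?eqxx //; case: (j) => //=; rewrite eqxx.
- rewrite /same_row eqxx /=; apply/implyP => /eqP ->.
  apply/implyP => /forallP H; apply/forallP => i; apply/implyP => /eqP i1.
  move: (H i); rewrite /right_of c0 !ffunE /= i1 /= => /eqP.
  move=> e; apply/eqP; rewrite nth_default // size_map.
  have [//|jw] := leqP (size w) j; first exact: leqW.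
  by rewrite (nth_map false) in e.
- rewrite eqxx /=; apply/and3P; split.
  + apply/implyP => /eqP ->; apply/forallP => i.
    by rewrite /right_of /read_of !ffunE /= nth0.
  + apply/implyP => /eqP ->; rewrite c0; apply/and3P; split.
    * apply/and4P; split => //.
      - by apply/forallP => i; rewrite /left_of !ffunE /= nth_nil.
      - apply/forallP => i; apply/implyP => /eqP i1; rewrite /right_of !ffunE /= i1 /=.
        have [jw|wj] := ltnP j (size w); first by rewrite (nth_map false).
        by rewrite nth_default // size_map.
      - apply/forallP => i; apply/implyP => i1; rewrite /right_of !ffunE /=.
        by rewrite [nth [::] _ i]nth_default //= nth_nil.
    * rewrite /right_of !ffunE /= /input_letter; case: ltnP => jx.
        by rewrite (nth_map false).
      by rewrite nth_default // size_map.
    * apply/implyP => Qj; apply/forallP => i; apply/implyP => /eqP i1.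
      rewrite /right_of !ffunE /= i1 /= nth_default // size_map.
      exact: leq_trans Qj.
  + apply/implyP => /eqP tW'; rewrite /last_row /state_of /=.
    have -> : t = W.-1 by lia.
    by rewrite hW aW.
- apply/forallP => i; have := step_c t i j; rewrite /= -cS.
  have -> : dir_of (tile_of (c t) j.+1) i = dir_of (tile_of (c t) j) i by [].
  by case: (dir_of _ i) => -[e1 e2]; rewrite ?e1 ?e2 //= eqxx.
Qed.

(** The word is cut at the first blank, or at length [Q] if no blank comes earlier. *)
Lemma onth_row_word (sym : nat -> letter) :
  (forall j, j < W -> is_bit (sym j)) -> (forall j, j < W -> Q <= j -> sym j = None) ->
  (forall j, j.+1 < W -> sym j = None -> sym j.+1 = None) ->
  exists2 w : word, size w <= Q &
    forall j, j < W -> sym j = nth None [seq Some (inl z) | z <- w] j.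
Proof.
move=> bit blank next.
pose m := find (fun j => sym j == None) (iota 0 Q).
have mQ : m <= Q by rewrite -[Q in _ <= Q](size_iota 0) find_size.
exists (mkseq (fun j => sym j == Some (inl true)) m); first by rewrite size_mkseq.
move=> j jW; have [jm|mj] := ltnP j m; last first.
  rewrite nth_default ?size_map ?size_iota //.
  suff : sym m = None.
    move=> sm; elim: j jW mj => [|j IH] jW; first by rewrite leqn0 => /eqP <-.
    by rewrite leq_eqVlt => /orP[/eqP <- //|mj]; apply: next => //; apply: IH => //; lia.
  have [mQ'|] := ltnP m Q; last by move=> Qm; apply: blank => //; lia.
  have /(nth_find 0) : has (fun j => sym j == None) (iota 0 Q) by rewrite has_find size_iota.
  by rewrite -/m nth_iota // => /eqP.
rewrite (nth_map false) ?size_mkseq // nth_mkseq //.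
have := before_find 0 jm; rewrite nth_iota; last exact: leq_trans mQ.
by have := bit j jW; rewrite add0n; case: (sym j) => [[[]|]|].
Qed.

(* Nothing is assumed at the right border of the grid, so wrong letters may enter there,
   but they move by one cell per step and never reach the triangle t + j < W. *)
Lemma tableau_sound valL valR : satisfied W (tableau x W Q) valL valR ->
  exists2 w, size w <= Q & accepts_in M W.-1 [:: x; w].
Proof.
move=> sat; pose v t j := valL (grid t j).
have eqLR t j : t < W -> j < W -> valR (grid t j) = v t j.
  move=> tW jW; have := sat (Some (false, false)) t j tW jW.
  by rewrite /= !addn0 => /and4P[/eqP].
have cell_ok t j : t < W -> j < W -> [/\ j = 0 -> head_row (v t j),
    t = 0 -> first_row x Q j (v t j) & t + 1 = W -> last_row (v t j)].
  move=> tW jW; have := sat (Some (false, false)) t j tW jW.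
  move=> /= /and4P[_ /implyP h1 /implyP h2 /implyP h3].
  by split=> /eqP.
have row_ok t j : t < W -> j.+1 < W -> same_row (v t j) (v t j.+1) /\
    (t = 0 -> contiguous (v t j) (v t j.+1)).
  move=> tW jW; have := sat (Some (false, true)) t j tW (ltnW jW).
  by rewrite /= addn0 addn1 eqLR // => /andP[-> /implyP h]; split=> // /eqP.
have below_ok t j : t.+1 < W -> j < W -> below (j == 0) (v t j) (v t.+1 j).
  move=> tW jW; have := sat (Some (true, false)) t j (ltnW tW) jW.
  by rewrite /= addn0 addn1 eqLR.
have right_ok t j : t.+1 < W -> j.+1 < W -> below_right (j == 0) (v t j) (v t.+1 j.+1).
  move=> tW jW; have := sat (Some (true, true)) t j (ltnW tW) (ltnW jW).
  by rewrite /= !addn1 eqLR.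
have left_ok t j : t.+1 < W -> j.+1 < W -> below_left (v t j.+1) (v t.+1 j).
  move=> tW jW; have := sat None t j (ltnW tW) (ltnW jW).
  by rewrite /= !addn1 eqLR // ltnW.
have row_const t j : t < W -> j < W -> (v t j).1 = (v t 0).1.
  move=> tW; elim: j => // j IH jW; have [/eqP <- _] := row_ok t j tW jW.
  exact: IH (ltnW jW).
have W0 : 0 < W by exact: leq_ltn_trans QW.
have [w wQ wE] : exists2 w : word, size w <= Q &
    forall j i, j < W -> i = 1 :> nat -> right_of (v 0 j) i = nth None [seq Some (inl z) | z <- w] j.
  (* Without a tape 1 all these letters count as blank, which gives the empty certificate. *)
  pose sym j : letter := if insub 1 is Some i then right_of (v 0 j) i else None.
  have on1 j (P : pred letter) : P None -> on_tape 1 P (v 0 j) -> P (sym j).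
    move=> P0 /forallP H; rewrite /sym; case: insubP => // i _ i1.
    by apply: (implyP (H i)); apply/eqP.
  have row0 j : j < W -> first_row x Q j (v 0 j) by move=> jW; have [_ ->] := cell_ok 0 j W0 jW.
  have [j jW|j jW Qj|j jW sj|w wQ wE] := @onth_row_word sym.
  - by apply: on1 => //; have /and3P[/and4P[]] := row0 j jW.
  - by apply/eqP; apply: (on1 j (pred1 None)) => //; have /and3P[_ _ /implyP ->] := row0 j jW.
  - apply/eqP; apply: (on1 j.+1 (pred1 None)) => //.
    have [_ /(_ erefl)/implyP] := row_ok 0 j W0 jW; apply.
    apply/forallP => i; apply/implyP => /eqP i1; move: sj; rewrite /sym.
    case: insubP => [i' _ i'1|]; last by rewrite -i1 ltn_ord.
    by move=> /= <-; apply/eqP; congr (right_of _ _); apply: ord_inj; rewrite i1 i'1.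
  - exists w => // j i jW i1; rewrite -wE // /sym.
    case: insubP => [i' _ i'1|]; last by rewrite -i1 ltn_ord.
    by congr (right_of _ _); apply: ord_inj; rewrite i1 i'1.
exists w => //; rewrite /accepts_in.
have [c c0 cS] : exists2 c, c 0 = init M [:: x; w] & forall t, c t.+1 = step (c t).
  by exists (fun t => run M t [:: x; w]).
have -> : run M W.-1 [:: x; w] = c W.-1.
  by elim: (W.-1) => [|t IH]; rewrite ?c0 // cS -IH.
have tileE a t j : state_of a = (c t).1 -> (forall i, read_of a i = tape_read ((c t).2 i)) ->
    (forall i, left_of a i = left_of (tile_of (c t) j) i) ->
    (forall i, right_of a i = right_of (tile_of (c t) j) i) -> a = tile_of (c t) j.
  case: a => [[q h] l]; rewrite /state_of /read_of /left_of /right_of /= => -> eh el er.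
  congr (_, _, _); apply/ffunP => i; rewrite !ffunE //.
  by move: (el i) (er i); rewrite !ffunE /=; case: (l i) => ? ? /= -> ->.
(* [head_row] ties the scanned letters to the cell at distance 0, and [same_row] carries them along
   the row. *)
have reads_ok t : t < W -> (forall i, right_of (v t 0) i = right_of (tile_of (c t) 0) i) ->
    forall j i, j < W -> read_of (v t j) i = tape_read ((c t).2 i).
  move=> tW H j i jW; rewrite /read_of row_const //.
  have [/(_ erefl)/forallP/(_ i)/eqP h _ _] := cell_ok t 0 tW W0.
  by rewrite -[RHS]nth0 -/(read_of _ _) -h H /right_of !ffunE /= nth0.
have main t : forall j, t + j < W -> v t j = tile_of (c t) j.
  elim: t => [|t IH] j tj.
    have row0 j' i : j' < W -> left_of (v 0 j') i = left_of (tile_of (c 0) j') i /\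
        right_of (v 0 j') i = right_of (tile_of (c 0) j') i.
      move=> jW; have [_ /(_ erefl)/and3P[/and4P[_ /forallP l0 _ /forallP r2] /eqP r0 _] _]
        := cell_ok 0 j' W0 jW.
      split; first by rewrite (eqP (l0 i)) c0 /left_of !ffunE /= nth_nil.
      rewrite c0 {2}/right_of !ffunE /=.
      case: (ltngtP i 1) => [i0|i2|i1].
      - have -> : i = ord0 by apply: val_inj => /=; lia.
        rewrite r0 /input_letter /=; case: ltnP => jx; first by rewrite (nth_map false).
        by rewrite nth_default // size_map.
      - rewrite (eqP (implyP (r2 i) i2)).
        by rewrite [nth [::] _ i]nth_default //= nth_nil.
      - by rewrite wE // i1.
    apply: tileE => [|i|i|i].
    - have [_ /(_ erefl)/and3P[/and4P[/eqP -> _ _ _] _ _] _] := cell_ok 0 j W0 tj.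
      by rewrite c0.
    - by apply: reads_ok => // i'; case: (row0 0 i' W0).
    - by case: (row0 j i tj).
    - by case: (row0 j i tj).
  have t1W : t.+1 < W by lia.
  have cells_ok j' i : t.+1 + j' < W ->
      left_of (v t.+1 j') i = left_of (tile_of (c t.+1) j') i /\
      right_of (v t.+1 j') i = right_of (tile_of (c t.+1) j') i.
    move=> tj'; have jW : j'.+1 < W by lia.
    have IH1 : v t j' = tile_of (c t) j' by apply: IH; lia.
    have IH2 : v t j'.+1 = tile_of (c t) j'.+1 by apply: IH; lia.
    have /andP[_ /forallP/(_ i) b0] := below_ok t j' t1W (ltnW jW).
    have /forallP/(_ i) bl := left_ok t j' t1W jW.
    have dirE k k' : dir_of (tile_of (c t) k) i = dir_of (tile_of (c t) k') i by [].
    have := step_tile (c t) i j'; rewrite /= -cS.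
    rewrite IH1 in b0; rewrite IH2 (dirE _ j') in bl.
    case: j' tj' jW IH1 IH2 b0 bl => [|j'] tj' jW IH1 IH2 b0 bl.
      move: b0 bl; case: (dir_of _ i) => /=.
      + by move=> /eqP -> /eqP -> [-> ->].
      + by move=> /andP[/eqP -> /eqP ->] _ [-> ->].
      + by move=> /eqP -> /eqP -> [-> ->].
    have IH0 : v t j' = tile_of (c t) j' by apply: IH; lia.
    have /forallP/(_ i) br := right_ok t j' t1W (ltnW jW).
    rewrite IH0 (dirE _ j'.+1) in br.
    move: b0 bl br; case: (dir_of _ i) => /=.
    + by move=> _ /eqP -> /eqP -> [-> ->].
    + by move=> /andP[/eqP -> /eqP ->] _ _ [-> ->].
    + by move=> _ /eqP -> /eqP -> [-> ->].
  apply: tileE => [|i|i|i].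
  - have /andP[/eqP -> _] := below_ok t j t1W ltac:(lia).
    by rewrite cS (next_stateE _ j) IH //; lia.
  - by apply: reads_ok => //; [move=> i'; apply: (cells_ok 0 i' _).2 | idtac]; lia.
  - by case: (cells_ok j i tj).
  - by case: (cells_ok j i tj).
have Wm : W.-1 + 0 < W by lia.
have := main W.-1 0 Wm => e.
have [_ _ h] := cell_ok W.-1 0 ltac:(lia) W0.
by have /andP[] := h ltac:(lia); rewrite e.
Qed.

End Correct.
End Tableau.

(** * NP-hardness *)

Lemma interval_graph_embed (R : realType) (G H : sgraph) (f : G -> H) :
  injective f -> (forall u v, edge (f u) (f v) = edge u v) ->
  interval_graph R H -> interval_graph R G.
Proof.
move=> f_inj fE [I [Ine Iedge]]; exists (I \o f); split=> [v|u v uv]; first exact: Ine.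
by rewrite -fE; apply: Iedge; rewrite (inj_eq f_inj).
Qed.

Lemma encode_inj (G H : sgraph) k l : 0 < k -> 0 < l -> encode G k = encode H l ->
  k = l /\ exists2 f : G -> H, injective f & forall u v, edge (f u) (f v) = edge u v.
Proof.
move=> k0 l0 e; have e' := esym e.
have GH : #|G| = #|H|.
  case: (ltngtP #|G| #|H|) => // lt; exfalso.
    by have := nth_encode_ones l0 e lt; rewrite (nth_encode_zero k0 erefl).
  by have := nth_encode_ones k0 e' lt; rewrite (nth_encode_zero l0 erefl).
split.
  rewrite -[k]bval_bits -[l]bval_bits -(drop_encode k0 (erefl (encode G k))).
  by rewrite -(drop_encode l0 (erefl (encode H l))) e GH.
exists (fun u => enum_val (cast_ord GH (enum_rank u))).
  by move=> u v /enum_val_inj/cast_ord_inj/enum_rank_inj.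
move=> u v; rewrite -(adj_encode k0 (erefl (encode G k))).
rewrite -(adj_encode l0 e) !enum_valK /adj /=.
by move: (nat_of_ord (enum_rank u)) (nat_of_ord (enum_rank v)) => a b; rewrite GH.
Qed.

(** The language asks for some graph with the given code; by [encode_inj] any such graph contains a
    copy of [G], to which a deletion set can be pulled back. *)
Lemma split_to_interval_encode (R : realType) (G : sgraph) k : 0 < k -> split_graph G ->
  split_to_interval R (encode G k) <->
  exists V : {set G}, #|V| <= k /\ interval_graph R (del_vertices V).
Proof.
move=> k0 Gs; split; last by move=> HV; exists G, k.
move=> [H [l [e _ l0 [V [Vl HI]]]]]; have [-> [f f_inj fE]] := encode_inj k0 l0 e.
exists (f @^-1: V); split.
  apply: leq_trans Vl; rewrite -(card_imset _ f_inj).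
  by apply/subset_leq_card/subsetP => _ /imsetP[u + ->]; rewrite inE.
have alive (u : del_vertices (f @^-1: V)) : f (val u) \in ~: V.
  by have := valP u; rewrite !inE.
pose g (u : del_vertices (f @^-1: V)) : del_vertices V := exist _ (f (val u)) (alive u).
apply: (@interval_graph_embed R _ _ g _ _ HI) => [u v [/f_inj/val_inj //]|u v].
exact: fE.
Qed.

Definition poly_expr (p : {poly nat}) e :=
  foldr (fun c acc => Add (Mul acc e) (Num c)) (Num 0) p.

Lemma value_poly_expr ws env p e :
  value ws env (poly_expr p e) = (p.[value ws env e])%R.
Proof. by rewrite /poly_expr /horner; elim: (polyseq p) => //= c s ->. Qed.

Section TableauQuery.
Variables (M : machine) (Wq Qq : expr).
Implicit Types (a b : tile M).

Definition letterq (s : letter M) j :=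
  match s with
  | None => QNot (QLt j (Len false))
  | Some (inl z) => QAnd (QLt j (Len false)) (if z then QBit false j else QNot (QBit false j))
  | Some (inr _) => QConst false
  end.

Definition if_zero e (c0 c1 : bool) :=
  QOr (QAnd (QEq e (Num 0)) (QConst c0)) (QAnd (QNot (QEq e (Num 0))) (QConst c1)).

(** Tiles are known when the program is written, so conditions on them become constants; coordinates
    and input letters are left to be queried. *)
Definition tableauq (c : ckind) a b t j :=
  match c with
  | Some (false, false) =>
      QAnd (QConst (a == b)) (QAnd (QImp (QEq j (Num 0)) (QConst (head_row a)))
        (QAnd (QImp (QEq t (Num 0)) (QAnd (QConst (first_row_fixed a))
            (QAnd (letterq (right_of a ord0) j)
              (QImp (QLe Qq j) (QConst (on_tape 1 (pred1 None) a))))))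
          (QImp (QEq (Add t (Num 1)) Wq) (QConst (last_row a)))))
  | Some (false, true) =>
      QAnd (QConst (same_row a b)) (QImp (QEq t (Num 0)) (QConst (contiguous a b)))
  | Some (true, false) => if_zero j (below true a b) (below false a b)
  | Some (true, true) => if_zero j (below_right true a b) (below_right false a b)
  | None => QConst (below_left a b)
  end.

Lemma ask_letterq x env s j :
  ask [:: x] env (letterq s j) = (s == input_letter M x (value [:: x] env j)).
Proof.
rewrite /input_letter; case: s => [[z|s]|] /=; case: ltnP => //= _.
- by case: z => /=; case: (nth _ _ _).
Qed.

Lemma ask_tableauq x W Q env c a b t j :
  value [:: x] env Wq = W -> value [:: x] env Qq = Q ->
  ask [:: x] env (tableauq c a b t j)
  = tableau x W Q c (value [:: x] env t) (value [:: x] env j) a b.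
Proof.
move=> eW eQ; case: c => [[[] []]|] //=; rewrite ?ask_letterq ?eW ?eQ //.
- by case: (_ == 0); rewrite ?orbF.
- by case: (_ == 0); rewrite ?orbF.
Qed.

End TableauQuery.

Lemma split_to_interval_NP_hard (R : realType) : NP_hard (split_to_interval R).
Proof.
move=> L [M [p [q HL]]].
pose n := Len false; pose Wq := Add (Add (poly_expr p n) (poly_expr q n)) (Num 1).
(* The last row [W - 1] is not before time p, and [W] exceeds q, so that row 0 has room for the
   certificate and a blank. *)
pose W (x : word) := (p.[size x])%R + (q.[size x])%R + 1.
have WqE x env : value [:: x] env Wq = W x by rewrite /= !value_poly_expr.
have QqE x env : value [:: x] env (poly_expr q n) = (q.[size x])%R by rewrite value_poly_expr.
pose allowed x := @tableau M x (W x) (q.[size x])%R.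
have allowedE x env c a b t j   := @ask_tableauq M _ _ _ _ _ _ c a b t j (WqE x env) (QqE x env).
pose d0 : tile M := (start M, [ffun=> None], [ffun=> (None, None)]).
(* A second tile makes the budget positive, as an instance requires. *)
pose d1 : tile M := (start M, [ffun=> Some (inl true)], [ffun=> (None, None)]).
have D1 : 1 < #|tile M|.
  apply/card_gt1P; exists d0, d1; split=> //; apply/eqP => -[/ffunP/(_ ord0)].
  by rewrite !ffunE.
have k0 x : 0 < budget (tile M) (W x).
  rewrite /budget !muln_gt0 /= subn_gt0 /W addn1 /= andbT.
  exact: leq_trans D1 (leq_pmulr _ (ltnW D1)).
pose prog := encode_cmd Wq (@tableauq M Wq (poly_expr q n)).
exists (fun x => emits [:: x] [::] prog); first exact: emits_poly_time.
move=> x; rewrite (emits_encode (allowed := allowed) WqE allowedE) //.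
rewrite split_to_interval_encode //; last exact: ggraph_split.
have QW : (q.[size x])%R < W x by rewrite /W addn1 ltnS leq_addl.
(* The machine has halted by time p, so the additional q steps change nothing. *)
have run_W w : size w <= (q.[size x])%R ->
    run M (W x).-1 [:: x; w] = run M (p.[size x])%R [:: x; w].
  move=> wq; rewrite /W addn1 /= addnC /run iterD step_halted //.
  exact: (HL x).1.
rewrite (HL x).2; split.
  move=> [w wq acc]; have [|vL [vR sat]] := @tableau_complete M x (W x) _ QW w wq.
    by rewrite /accepts_in run_W.
  exact: reduction_complete sat.
move=> [V [Vk HI]]; have [vL [vR sat]] := reduction_sound d0 Vk HI.
have [w wq acc] := tableau_sound QW sat; exists w => //.
by move: acc; rewrite /accepts_in run_W.
Qed.

Theorem theorem9 (R : realType) : NP_complete (split_to_interval R).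
Proof. by split; [exact: split_to_interval_in_NP | exact: split_to_interval_NP_hard]. Qed.
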